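(* Let $n\in\mathbb{N}$. Then $\mathrm{HS}_{n,p}(\boldsymbol X,\boldsymbol Y)$ is a rational function in $\boldsymbol X=(X_1,\dots,X_n)$ and $\boldsymbol Y=(Y_1,\dots,Y_n)$. Furthermore, for $\boldsymbol X^{-1}=(X_1^{-1},\dots,X_n^{-1})$ and $\boldsymbol Y^{-1}=(Y_1^{-1},\dots,Y_n^{-1})$, we have $$\mathrm{HS}_{n,p}(\boldsymbol X^{-1},\boldsymbol Y^{-1})\big|_{p\to p^{-1}}=(-1)^np^{\binom n2}X_nY_1\cdots Y_n\cdot\mathrm{HS}_{n,p}(\boldsymbol X,\boldsymbol Y).$$
   Context: Let $p$ be a prime and $\mathbb{Z}_p$ the ring of $p$-adic integers. For a finite-index $\mathbb{Z}_p$-sublattice $\Lambda\le\mathbb{Z}_p^n$ let $\nu_1\le\cdots\le\nu_n$ be the non-negative integers with $\mathbb{Z}_p^n/\Lambda\cong\mathbb{Z}/p^{\nu_1}\oplus\cdots\oplus\mathbb{Z}/p^{\nu_n}$, set $\nu_0=0$ and $(\mu_1(\Lambda),\dots,\mu_n(\Lambda))=(\nu_n-\nu_{n-1},\dots,\nu_1-\nu_0)$. Let $(\delta_1(\Lambda),\dots,\delta_n(\Lambda))\in\mathbb{N}_0^n$ be the exponents such that the Hermite normal form of $\Lambda$ (an upper triangular matrix over $\mathbb{Z}_p$ whose rows generate $\Lambda$ and whose diagonal entries are powers of $p$) has diagonal $(p^{\delta_1},\dots,p^{\delta_n})$. The Hermite–Smith generating function is $$\mathrm{HS}_{n,p}(\boldsymbol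 X,\boldsymbol Y)=\sum_{\Lambda\le\mathbb{Z}_p^n}\prod_{i=1}^nX_i^{\mu_i(\Lambda)}Y_i^{\delta_i(\Lambda)}\in\mathbb{Z}[\![\boldsymbol X,\boldsymbol Y]\!],$$ the sum running over all finite-index sublattices of $\mathbb{Z}_p^n$. The operation $p\to p^{-1}$ is the operation of inverting the prime $p$ explained in Voll's 2010 work on functional equations for zeta functions of groups and rings: for $p$-adic integrals expressed as finite sums of products of numbers of $\mathbb{F}_p$-rational points of smooth projective varieties with rational functions in $p$ and the variables, one replaces $p$ by $p^{-1}$ in the rational functions and inverts the Frobenius eigenvalues in the point counts. *)

(* Defs.v *)
From HB Require Import structures.
From mathcomp Require Import all_boot all_order all_algebra.
From mathcomp Require Import boolp classical_sets cardinality fsbigop.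
From mathcomp Require Import fraction mpoly.

Set Implicit Arguments.
Unset Strict Implicit.
Unset Printing Implicit Defensive.

Import Order.TTheory GRing.Theory Num.Theory.
Local Open Scope ring_scope.

(* An element of Z_p = lim Z/p^k is the sequence of its canonical residues:   *)
(* [residue x k] is the representative in [0, p^k) of x modulo p^k.           *)
Record padic_int (p : nat) := PadicInt {
  residue : nat -> int;
  residueK : forall k, (residue k = residue k.+1 %% (p ^ k)%N)%Z }.

Section PadicRing.
Variable p : nat.
Implicit Types x y z : padic_int p.

HB.instance Definition _ := gen_eqMixin (padic_int p).
HB.instance Definition _ := gen_choiceMixin (padic_int p).

Lemma padicP x y : residue x =1 residue y -> x = y.
Proof.
case: x y => [f fP] [g gP] /= /funext fg; subst g; congr PadicInt.
exact: Prop_irrelevance.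
Qed.

Lemma residue_mod x k : (residue x k %% (p ^ k)%N)%Z = residue x k.
Proof. by rewrite residueK modz_mod. Qed.

Lemma modz_pS (a : int) k :
  modz (modz a (p ^ k.+1)%N) (p ^ k)%N = modz a (p ^ k)%N.
Proof.
apply/eqP; rewrite eqz_mod_dvd {2}(divz_eq a (p ^ k.+1)%N) opprD addrCA subrr.
by rewrite addr0 expnSr PoszM mulrA mulrAC rpredN dvdz_mull.
Qed.

Lemma of_int_subproof (f : nat -> int) :
  (forall k, (f k = f k.+1 %[mod (p ^ k)%N])%Z) ->
  forall k, modz (f k) (p ^ k)%N = modz (modz (f k.+1) (p ^ k.+1)%N) (p ^ k)%N.
Proof. by move=> fP k; rewrite modz_pS fP. Qed.

Definition padic_of (f : nat -> int) fP := PadicInt (@of_int_subproof f fP).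

Lemma residueS x k : (residue x k = residue x k.+1 %[mod (p ^ k)%N])%Z.
Proof. by rewrite {1}residueK modz_mod. Qed.

Lemma padic_add_subproof x y k :
  (residue x k + residue y k = residue x k.+1 + residue y k.+1
     %[mod (p ^ k)%N])%Z.
Proof. by rewrite -modzDm residueS (residueS y) modzDm. Qed.

Lemma padic_opp_subproof x k :
  (- residue x k = - residue x k.+1 %[mod (p ^ k)%N])%Z.
Proof. by rewrite -modzNm residueS modzNm. Qed.

Lemma padic_mul_subproof x y k :
  (residue x k * residue y k = residue x k.+1 * residue y k.+1
     %[mod (p ^ k)%N])%Z.
Proof. by rewrite -modzMm residueS (residueS y) modzMm. Qed.

Definition padic_cst (a : int) : padic_int p :=
  @padic_of (fun=> a) (fun k => erefl).
Definition padic_add x y := padic_of (padic_add_subproof x y).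
Definition padic_opp x := padic_of (padic_opp_subproof x).
Definition padic_mul x y := padic_of (padic_mul_subproof x y).

Fact padic_addA : associative padic_add.
Proof. by move=> x y z; apply: padicP => k /=; rewrite modzDml modzDmr addrA. Qed.
Fact padic_addC : commutative padic_add.
Proof. by move=> x y; apply: padicP => k /=; rewrite addrC. Qed.
Fact padic_add0 : left_id (padic_cst 0) padic_add.
Proof. by move=> x; apply: padicP => k /=; rewrite modzDml add0r residue_mod. Qed.
Fact padic_addN : left_inverse (padic_cst 0) padic_opp padic_add.
Proof. by move=> x; apply: padicP => k /=; rewrite modzDml addNr. Qed.

HB.instance Definition _ := GRing.isZmodule.Build (padic_int p)
  padic_addA padic_addC padic_add0 padic_addN.

Fact padic_mulA : associative padic_mul.
Proof. by move=> x y z; apply: padicP => k /=; rewrite modzMml modzMmr mulrA. Qed.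
Fact padic_mulC : commutative padic_mul.
Proof. by move=> x y; apply: padicP => k /=; rewrite mulrC. Qed.
Fact padic_mul1 : left_id (padic_cst 1) padic_mul.
Proof. by move=> x; apply: padicP => k /=; rewrite modzMml mul1r residue_mod. Qed.
Fact padic_mulDl : left_distributive padic_mul padic_add.
Proof.
by move=> x y z; apply: padicP => k /=; rewrite modzMml modzDml modzDmr mulrDl.
Qed.

HB.instance Definition _ := GRing.Zmodule_isComPzRing.Build (padic_int p)
  padic_mulA padic_mulC padic_mul1 padic_mulDl.

End PadicRing.

Section Lattices.
Variables (n p : nat).
Local Notation Zpn := 'rV[padic_int p]_n.
Local Open Scope classical_set_scope.
Implicit Types L : set Zpn.

Definition sublattice L := GRing.submod_closed (mem L).

Definition finite_index L :=
  finite_set [set [set v + u | u in L] | v in [set: Zpn]].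

(* Z_p^n / L is isomorphic to the direct sum of the cyclic groups Z/p^(nu i), *)
(* given by a surjection from Z_p^n with kernel L; 'I_q.+1 is Z/(q + 1), the  *)
(* trivial group for q = 0.                                                   *)
Definition quotient_type L (nu : n.-tuple nat) :=
  exists phi : forall i : 'I_n,
      {additive Zpn -> 'I_(p ^ tnth nu i).-1.+1},
    (forall t : (forall i : 'I_n, 'I_(p ^ tnth nu i).-1.+1),
        exists v, forall i, phi i v = t i)
    /\ (forall v, L v <-> forall i, phi i v = 0).

Definition nu L : n.-tuple nat :=
  xget [tuple 0%N | _ < n]
    [set s : n.-tuple nat | sorted leq s /\ quotient_type L s].

(* Indices start at 0 here: with nu_0 = 0 and nu_1 <= ... <= nu_n the entries *)
(* of [nu L], the value at i : 'I_n is nu_(n-i) - nu_(n-i-1).                 *)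
Definition mu L (i : 'I_n) : nat :=
  nth 0%N (0%N :: nu L) (n - i) - nth 0%N (0%N :: nu L) (n - i.+1).

Definition hermite_matrix L (d : n.-tuple nat) (H : 'M[padic_int p]_n) :=
  [/\ forall i j : 'I_n, (j < i)%N -> H i j = 0,
      forall i, H i i = p%:R ^+ tnth d i
    & L = [set u *m H | u in [set: Zpn]]].

Definition delta L : n.-tuple nat :=
  xget [tuple 0%N | _ < n]
    [set d : n.-tuple nat | exists H, hermite_matrix L d H].

(* The exponent of the monomial X^mu(L) Y^delta(L); the first n of the n + n  *)
(* variables are the X_i, the last n are the Y_i.                             *)
Definition hs_exponent L : 'X_{1.. n + n} :=
  [multinom match split k with inl i => mu L i | inr i => tnth (delta L) i end
     | k < n + n].

(* Formal power series are given by their coefficients. Only finitely many L  *)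
(* contribute to each coefficient: delta(L) determines the index of L.        *)
Definition HS (m : 'X_{1.. n + n}) : int :=
  \sum_(L \in [set L | sublattice L /\ finite_index L]) ((hs_exponent L == m)%:R : int).

End Lattices.

Section Rational.

Definition series (N : nat) := 'X_{1.. N} -> int.

Definition poly_mul_series N (D : {mpoly int[N]}) (F : series N) : series N :=
  fun m => \sum_(k <- msupp D | (k <= m)%MM) D@_k * F (m - k)%MM.

(* F = A / D: D * F = A in the domain of formal power series, with D <> 0.    *)
Definition is_quotient N (F : series N) (A D : {mpoly int[N]}) :=
  D != 0 /\ forall m, poly_mul_series D F m = A@_m.

Definition rational_series N (F : series N) := exists A D, is_quotient F A D.

Variable n : nat.

(* Polynomials and rational functions in T, X_1..X_n, Y_1..Y_n, where T is a  *)
(* variable standing for the prime.                                           *)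
Definition polyTXY := {mpoly int[1 + (n + n)]}.
Definition ratTXY := {fraction polyTXY}.

Definition varT : ratTXY := FracField.tofrac 'X_(lshift (n + n) ord0).
Definition varX (i : 'I_n) : ratTXY :=
  FracField.tofrac 'X_(rshift 1 (lshift n i)).
Definition varY (i : 'I_n) : ratTXY :=
  FracField.tofrac 'X_(rshift 1 (rshift n i)).

Definition eval_prime (p : nat) (A : polyTXY) : {mpoly int[n + n]} :=
  mmap intr
    (fun k => match split k with inl _ => p%:R | inr j => 'X_j end) A.

Definition specializes (W : ratTXY) (p : nat) (F : series (n + n)) :=
  exists A D : polyTXY,
    W = FracField.tofrac A / FracField.tofrac D
    /\ is_quotient F (eval_prime p A) (eval_prime p D).

(* The family F of series, indexed by the primes, is given by one rational    *)
(* function W of the prime and the variables. Such a W is unique, as there    *)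
(* are infinitely many primes. This makes p -> p^-1 meaningful: for a family  *)
(* given by rational functions in p alone (no point counts of varieties other *)
(* than a point) the operation substitutes T^-1 for T in W.                   *)
Definition uniformly_rational (F : nat -> series (n + n)) (W : ratTXY) :=
  forall p, prime p -> specializes W p (F p).

Definition invert_poly (A : polyTXY) : ratTXY :=
  mmap intr (fun k => (FracField.tofrac 'X_k)^-1) A.

(* W(T^-1, X^-1, Y^-1); it does not depend on the chosen numerator and        *)
(* denominator since [invert_poly] is an injective ring morphism.             *)
Definition invert (W : ratTXY) : ratTXY :=
  invert_poly \n_(repr W) / invert_poly \d_(repr W).

End Rational.

(* Main.v *)
Require Import Defs.
From HB Require Import structures.
From mathcomp Require Import all_boot all_order all_algebra.
From mathcomp Require Import boolp classical_sets cardinality fsbigop.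
From mathcomp Require Import fraction mpoly.
From mathcomp Require Import ring lra zify.
Set Implicit Arguments.
Unset Strict Implicit.
Unset Printing Implicit Defensive.
Import Order.TTheory GRing.Theory Num.Theory.
Local Open Scope ring_scope.

(** Write T for the prime p, and encode the type of a lattice by the partition
    whose parts are the exponents nu_i. A column of height h of this partition
    contributes X_h to the monomial X^mu; columns of height 0 contribute
    X_0 = 1.

    The proof is a recursion on the rank. A lattice L in rank n + 1 is given by
    its intersection M with the hyperplane x_1 = 0, the exponent d = delta_1,
    and a class h modulo M; this is [ext d h M], and delta (ext d h M) is d
    followed by delta M. The type of L is read off column by column, because
    passing from L to the set of all v with p v in L removes the first column
    of the type ([pres_div]). The first column of L is as high as that of M, or
    higher by one; the latter happens exactly when d > 0 and h lies in
    p Z_p^n + M ([rank_ext]). In both cases the enlarged lattice is again an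
    extension, now of the set of all b with p b in M ([div_ext_box],
    [div_ext_nobox]). Counting the
    classes h along this process shows that the generating function of the
    extensions of M is computed by 2 x 2 matrices ([ext_gf_transfer]): a column
    of height r acts by an upper triangular matrix with eigenvalues
    up r = y X_(r+1) and lo r = T^r X_r, where y is the new variable Y_1, and
    going down from height r to r - 1 acts by a fixed lower triangular matrix.

    Diagonalising the n matrices that belong to positive heights turns the
    matrix product into a sum over bit strings s of length n, which choose an
    eigenvalue for every height. A term depends on the type of M only through
    the substitution of the chosen eigenvalues for X_1, ..., X_n. Hence
      HS_(n+1)(X, Y) = sum_s (branch_coef s / gaps) HS_n(subst_vars s X, Y'),
    Y' being Y without Y_1 ([gaps_ext_gf], [enum_step], [hs_trunc]). This gives
    a numerator and a denominator by formulas that make sense in every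
    commutative ring and in which p occurs as a ring element; so one rational
    function in T, X, Y serves all primes. The denominator does not vanish, as
    it is positive at suitable rational points ([hs_den_gt0]).

    The functional equation holds term by term in this recursion
    ([branch_coefV], [hs_fracV]). The coefficient of s is a product of one
    factor for each pair of neighbouring heights and one for the top height.
    Inverting all variables multiplies each factor of the first kind by -1/T and
    a monomial. The monomials cancel against those of the common denominator
    except at the top height, and what remains is
    -T^n times the ratio between y X_(n+1) and the variable substituted for
    X_n, which is what the induction step needs.

    Formal power series are only used through truncations: modulo terms of
    degree above k the series HS is a finite sum, over the lattices that
    contain p^k Z_p^n ([HS_sum], [mul_series]). Finally, a rational function
    that specialises to HS at every prime is unique, since a polynomial that
    vanishes at infinitely many values of T is zero ([eval_primes_inj]). *)

(** * The recursive numerator and denominator *)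

Section Substitutions.
Variable R : comNzRingType.
Implicit Types (T y : R) (X Y : nat -> R) (s : seq bool).

(** The two eigenvalues that belong to columns of height r; see [col_step]. *)
Definition up X y r := y * X r.+1.
Definition lo T X r := T ^+ r * X r.
Definition branch T X y (b : bool) r := if b then up X y r else lo T X r.

(** The head of a bit string of length n is the choice made at height n, the
    true bit standing for [up]. *)
Fixpoint bits n : seq (seq bool) :=
  if n is n'.+1 then [seq b :: s | b <- [:: true; false], s <- bits n']
  else [:: [::]].

(** At height 0 the choice is always [lo], whose value there is X_0 = 1; the
    same default is used above the length of the string. *)
Fixpoint bit s r : bool :=
  if s is b :: s' then (if r == (size s').+1 then b else bit s' r) else false.

Definition subst_vars T X y s r := branch T X y (bit s r) r.

(** The factor for the heights r and r - 1: a row eigenvector at height r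
    paired with the image of a column eigenvector at height r - 1; see
    [linkE]. *)
Definition link T X y r (b b' : bool) :=
  match b, b' with
  | true, true => lo T X r - T * up X y r
  | true, false => lo T X r * up X y r.-1 - T * up X y r * lo T X r.-1
  | false, true => T - 1
  | false, false => T * lo T X r.-1 - up X y r.-1
  end.

Fixpoint links T X y s :=
  if s is b :: s' then link T X y (size s) b (head false s') * links T X y s'
  else 1.

Definition branch_coef T X y s :=
  (if head false s then 1 else lo T X (size s)) * links T X y s.

(** The differences are the denominators of the spectral projections; the one
    for r = 0 comes from the geometric series in the unbounded part of the
    largest exponent. The power of T clears the denominators of the steps
    between heights. *)
Definition gaps T X y n := T ^+ n * \prod_(r < n.+1) (lo T X r - up X y r).

(** Common denominator and numerator of the recursion. They are defined over
    an arbitrary commutative ring, so that the same expression can be read with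
    the prime as a number or as a variable, and with inverted variables. *)
Fixpoint hs_den n T X Y : R :=
  if n is n'.+1 then
    gaps T X (Y 0%N) n'
      * \prod_(s <- bits n') hs_den n' T (subst_vars T X (Y 0%N) s) (Y \o succn)
  else 1.

Fixpoint hs_num n T X Y : R :=
  if n is n'.+1 then
    \sum_(s <- bits n') branch_coef T X (Y 0%N) s
      * hs_num n' T (subst_vars T X (Y 0%N) s) (Y \o succn)
      * \prod_(s' <- bits n' | s' != s)
          hs_den n' T (subst_vars T X (Y 0%N) s') (Y \o succn)
  else 1.

Lemma size_bits n s : s \in bits n -> size s = n.
Proof.
elim: n s => [|n IHn] s; first by rewrite inE => /eqP->.
by move=> /allpairsP[[b s'] /= [_ /IHn <- ->]].
Qed.

Lemma uniq_bits n : uniq (bits n).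
Proof.
elim: n => //= n IHn; rewrite cats0 cat_uniq !map_inj_uniq ?IHn ?andbT //;
  try by move=> s s' [].
by apply/hasPn => _ /mapP[s _ ->]; apply/mapP => -[s'].
Qed.

Lemma sum_bitsS (F : seq bool -> R) n :
  \sum_(s <- bits n.+1) F s
  = \sum_(s <- bits n) (F (true :: s) + F (false :: s)).
Proof. by rewrite /= cats0 big_cat /= !big_map -big_split. Qed.

Lemma bit0 s : bit s 0 = false.
Proof. by elim: s. Qed.

Lemma bit_size s : bit s (size s) = head false s.
Proof. by case: s => //= b s; rewrite eqxx. Qed.

Lemma bit_cons b s r : (r <= size s)%N -> bit (b :: s) r = bit s r.
Proof. by move=> le_rs; rewrite /= ltn_eqF. Qed.

Lemma subst0 T X y s : subst_vars T X y s 0 = X 0%N.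
Proof. by rewrite /subst_vars bit0 /branch /lo mul1r. Qed.

Lemma eq_hs_den n T X X' Y Y' :
  (forall i, (i <= n)%N -> X i = X' i) -> (forall i, (i < n)%N -> Y i = Y' i) ->
  hs_den n T X Y = hs_den n T X' Y'.
Proof.
elim: n X X' Y Y' => //= n IHn X X' Y Y' eqX eqY.
have up_eq i : (i <= n)%N -> up X (Y 0%N) i = up X' (Y' 0%N) i.
  by move=> le_in; rewrite /up eqX // eqY.
have lo_eq i : (i <= n)%N -> lo T X i = lo T X' i.
  by move=> le_in; rewrite /lo eqX // leqW.
congr (_ * _).
  by congr (_ * _); apply: eq_bigr => r _; rewrite up_eq ?lo_eq // -ltnS.
apply: eq_bigr => s _; apply: IHn => i lt_i /=; last exact: eqY.
by rewrite /subst_vars /branch; case: (bit s i); [apply: up_eq | apply: lo_eq].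
Qed.

End Substitutions.

Section Morphism.
Variables (R S : comNzRingType) (f : {rmorphism R -> S}).
Implicit Types (T y : R) (X Y : nat -> R).

Lemma rmorph_up X y r : f (up X y r) = up (f \o X) (f y) r.
Proof. by rewrite rmorphM. Qed.
Lemma rmorph_lo T X r : f (lo T X r) = lo (f T) (f \o X) r.
Proof. by rewrite rmorphM rmorphXn. Qed.
Lemma rmorph_subst T X y s : f \o subst_vars T X y s = subst_vars (f T) (f \o X) (f y) s.
Proof.
apply/funext => r; rewrite /= /subst_vars /branch.
by case: (bit s r); rewrite ?rmorph_up ?rmorph_lo.
Qed.

Lemma rmorph_branch_coef T X y s :
  f (branch_coef T X y s) = branch_coef (f T) (f \o X) (f y) s.
Proof.
rewrite rmorphM; congr (_ * _).
  by case: (head _ _); rewrite ?rmorph1 ?rmorph_lo.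
elim: s => [|b s IHs] /=; first by rewrite rmorph1.
rewrite rmorphM IHs; congr (_ * _).
by case: b; case: (head false s);
  rewrite /up /lo /= rmorphB ?rmorph1 // ?rmorphM ?rmorphXn.
Qed.

Lemma rmorph_gaps T X y n : f (gaps T X y n) = gaps (f T) (f \o X) (f y) n.
Proof.
rewrite rmorphM rmorphXn rmorph_prod; congr (_ * _); apply: eq_bigr => r _.
by rewrite rmorphB rmorph_up rmorph_lo.
Qed.

Lemma rmorph_hs_den n T X Y :
  f (hs_den n T X Y) = hs_den n (f T) (f \o X) (f \o Y).
Proof.
elim: n X Y => [|n IHn] X Y /=; first by rewrite rmorph1.
rewrite rmorphM rmorph_gaps rmorph_prod; congr (_ * _).
by apply: eq_bigr => s _; rewrite IHn rmorph_subst.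
Qed.

Lemma rmorph_hs_num n T X Y :
  f (hs_num n T X Y) = hs_num n (f T) (f \o X) (f \o Y).
Proof.
elim: n X Y => [|n IHn] X Y /=; first by rewrite rmorph1.
rewrite rmorph_sum; apply: eq_bigr => s _.
rewrite 2!rmorphM rmorph_branch_coef IHn rmorph_subst rmorph_prod; congr (_ * _).
by apply: eq_bigr => s' _; rewrite rmorph_hs_den rmorph_subst.
Qed.

End Morphism.

(** The hypotheses say that up < lo at every height and that Y decreases
    faster than the powers of T^-1. They are inherited by the substituted
    variables whatever the bit string: the worst case pairs lo at height r + 1
    with up at height r. *)
Lemma hs_den_gt0 (F : realFieldType) n (T : F) (X Y : nat -> F) :
  0 < T -> X 0%N = 1 -> (forall i, 0 < X i) -> (forall i, 0 < Y i) ->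
  (forall i, T * Y i.+1 < Y i) ->
  (forall r, up X (Y 0%N) r < lo T X r) ->
  0 < hs_den n T X Y.
Proof.
move=> T0; elim: n X Y => //= n IHn X Y X0 Xpos Ypos Ydec lt_ul.
have up0 r : 0 < up X (Y 0%N) r by rewrite mulr_gt0.
have lo0 r : 0 < lo T X r by exact: lt_trans (lt_ul r).
rewrite mulr_gt0 //.
  rewrite mulr_gt0 ?exprn_gt0 // prodr_gt0 // => r _.
  by rewrite subr_gt0.
rewrite prodr_gt0 // => s _; apply: IHn => //=; first by rewrite subst0.
- by move=> r; rewrite /subst_vars /branch; case: (bit s r).
- move=> r; set X' := subst_vars _ _ _ _.
  have le_lo : X' r.+1 <= lo T X r.+1.
    by rewrite /X' /subst_vars /branch; case: (bit s _) => //; apply/ltW.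
  have le_up : up X (Y 0%N) r <= X' r.
    by rewrite /X' /subst_vars /branch; case: (bit s _) => //; apply/ltW.
  (* Replace X' by its largest value at r + 1 and its smallest value at r. *)
  apply: le_lt_trans (_ : Y 1%N * lo T X r.+1 < _).
    by rewrite /up /= ler_pM2l.
  apply: lt_le_trans (_ : T ^+ r * up X (Y 0%N) r <= _); last first.
    by rewrite /lo ler_pM2l ?exprn_gt0.
  have -> : Y 1%N * lo T X r.+1 = T ^+ r * X r.+1 * (T * Y 1%N).
    by rewrite /lo exprS; ring.
  have -> : T ^+ r * up X (Y 0%N) r = T ^+ r * X r.+1 * Y 0%N.
    by rewrite /up; ring.
  by rewrite ltr_pM2l ?mulr_gt0 ?exprn_gt0.
Qed.

(** * Inverting all variables *)

Section FunctionalEquation.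
Variable F : fieldType.
Implicit Types (T y : F) (X Y : nat -> F) (s : seq bool).

Fixpoint hs_frac n T X Y : F :=
  if n is n'.+1 then
    \sum_(s <- bits n') branch_coef T X (Y 0%N) s / gaps T X (Y 0%N) n'
      * hs_frac n' T (subst_vars T X (Y 0%N) s) (Y \o succn)
  else 1.

Lemma hs_fracE n T X Y :
  hs_den n T X Y != 0 -> hs_frac n T X Y = hs_num n T X Y / hs_den n T X Y.
Proof.
elim: n X Y => [|n IHn] X Y /=; first by rewrite divr1.
rewrite mulf_eq0 negb_or => /andP[g0]; rewrite prodf_seq_neq0 => d0.
rewrite mulr_suml; apply: eq_big_seq => s sP.
have /= ds0 := allP d0 s sP; rewrite IHn //.
rewrite (bigD1_seq s) ?uniq_bits //=.
set P := \prod_(_ <- _ | _) _.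
have P0 : P != 0.
  by rewrite prodf_seq_neq0; apply: sub_all d0 => s' /= ->; rewrite implybT.
by field; rewrite P0 ds0 g0.
Qed.

Lemma upV X y r : up (fun i => (X i)^-1) y^-1 r = (up X y r)^-1.
Proof. by rewrite /up invfM. Qed.
Lemma loV T X r : lo T^-1 (fun i => (X i)^-1) r = (lo T X r)^-1.
Proof. by rewrite /lo exprVn invfM. Qed.
Lemma substV T X y s :
  subst_vars T^-1 (fun i => (X i)^-1) y^-1 s = (fun i => (subst_vars T X y s i)^-1).
Proof.
by apply/funext => r; rewrite /subst_vars /branch; case: (bit s r); rewrite ?upV ?loV.
Qed.

Section Inversion.
Variables (T y : F) (X : nat -> F).
Hypotheses (T0 : T != 0) (y0 : y != 0) (X0 : forall i, X i != 0).
Let XV i := (X i)^-1.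

Let up0 r : up X y r != 0. Proof. by rewrite mulf_neq0. Qed.
Let lo0 r : lo T X r != 0. Proof. by rewrite mulf_neq0 ?expf_neq0. Qed.

(** Each factor [link] is multiplied by -1/T, by the inverse of up * lo at the
    upper height if the upper bit is up, and by the inverse of up * lo at the
    lower height if the lower bit is lo. So every height below the top contributes
    exactly once, whichever bit it carries. *)
Lemma linksV s :
  links T^-1 XV y^-1 s = (- T^-1) ^+ size s * links T X y s
    * (\prod_(r < size s) (up X y r * lo T X r)^-1)
    * (if head false s then (up X y (size s) * lo T X (size s))^-1 else 1).
Proof.
elim: s => [|b s IHs]; first by rewrite /= big_ord0 !mulr1.
rewrite [LHS]/= IHs big_ord_recr /=.
have E r : r.+1.-1 = r by [].
have := up0 (size s); have := lo0 (size s).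
have := up0 (size s).+1; have := lo0 (size s).+1.
rewrite /link /XV !upV !loV [(size s).+1.-1]E.
set a := up _ _ (size s); set b' := lo _ _ (size s).
set c := up _ _ _; set d := lo _ _ _ => d0 c0 b0 a0.
rewrite exprS; set P := \prod_(_ < _) _; set e := (- _) ^+ _; set L := links _ _ _ _.
case: b; case: (head false s); field; rewrite ?a0 ?b0 ?c0 ?d0 ?T0 //.
Qed.

Lemma gapsV n :
  gaps T^-1 XV y^-1 n = (-1) ^+ n.+1 * T^-1 ^+ n
   * (\prod_(r < n.+1) (lo T X r - up X y r))
   * \prod_(r < n.+1) (up X y r * lo T X r)^-1.
Proof.
rewrite /gaps -!mulrA mulrCA; congr (_ * _).
rewrite -[in (-1) ^+ _](card_ord n.+1) -prodr_const -!big_split /=.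
apply: eq_bigr => r _; rewrite /XV upV loV.
by field; rewrite up0 lo0.
Qed.

(** The monomials of [linksV] and [gapsV] cancel, except at the top height,
    where the first factor of [branch_coef] also enters. *)
Lemma branch_coefV s :
  branch_coef T^-1 XV y^-1 s / gaps T^-1 XV y^-1 (size s)
  = - T ^+ size s * (if head false s then 1 else up X y (size s) / lo T X (size s))
    * (branch_coef T X y s / gaps T X y (size s)).
Proof.
rewrite /branch_coef gapsV linksV /gaps loV !big_ord_recr /=.
set D := \prod_(_ < _) (_ - _); set P := \prod_(_ < _) _^-1.
have P0 : P != 0.
  by apply/prodf_neq0 => r _; rewrite invr_neq0 // mulf_neq0.
have := up0 (size s); have := lo0 (size s).
set a := up _ _ _; set b := lo _ _ _ => b0 a0.
set L := links _ _ _ _.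
rewrite exprS [(- T^-1) ^+ _]exprNn !exprVn.
have S0 : (-1 : F) ^+ size s != 0 by rewrite signr_eq0.
have TT0 : T ^+ size s != 0 by rewrite expf_neq0.
have [z|z] := eqVneq (D * (b - a)) 0.
  (* If some gap vanishes both sides are 0, because 0^-1 = 0. *)
  by rewrite z !(mulr0, mul0r, invr0).
move: z; rewrite mulf_eq0 negb_or => /andP[D0 ba0].
move: ((-1) ^+ _) (T ^+ _) S0 TT0 => e t S0 TT0.
by case: (head false s); field; rewrite ?a0 ?b0 ?P0 ?S0 ?TT0 ?D0 ?ba0 ?oppr_eq0 ?oner_neq0.
Qed.

End Inversion.

(** Every summand of the recursion satisfies the equation separately: the
    factor X_n of the induction hypothesis becomes up n or lo n, and
    [branch_coefV] turns either of them into -T^n up n = -T^n Y_1 X_(n+1). *)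
Lemma hs_fracV n T X Y : T != 0 -> X 0%N = 1 -> (forall i, X i != 0) ->
  (forall i, Y i != 0) ->
  hs_frac n T^-1 (fun i => (X i)^-1) (fun i => (Y i)^-1)
  = (-1) ^+ n * T ^+ 'C(n, 2) * X n * (\prod_(i < n) Y i) * hs_frac n T X Y.
Proof.
move=> T0; elim: n X Y => [|n IHn] X Y X00 X0 Y0.
  by rewrite /= X00 big_ord0 !mulr1.
rewrite /= mulr_sumr; apply: eq_big_seq => s /size_bits sn.
rewrite -{1 2}sn branch_coefV // sn substV.
have sub0 i : subst_vars T X (Y 0%N) s i != 0.
  by rewrite /subst_vars /branch; case: (bit s i); rewrite mulf_neq0 ?expf_neq0.
rewrite (IHn _ (Y \o succn)) ?subst0 //; last by move=> i /=.
rewrite big_ord_recl /= /bump /=.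
rewrite exprS binS bin1 exprD.
have -> : subst_vars T X (Y 0%N) s n = if head false s then up X (Y 0%N) n else lo T X n.
  by rewrite /subst_vars -{1}sn bit_size.
have l0 : lo T X n != 0 by rewrite mulf_neq0 ?expf_neq0.
set c := _ / gaps _ _ _ _.
case: (head false s).
  by rewrite /up; ring.
by rewrite /up; field.
Qed.

End FunctionalEquation.

(** * Residue vectors and the weights of extensions *)

Definition drop_col (mu : seq nat) := [seq a.-1 | a <- mu].
Definition rk (mu : seq nat) := count (ltn 0) mu.
(** The heights of the first k columns, including columns of height 0. *)
Definition col_heights k (mu : seq nat) := [seq count (ltn j) mu | j <- iota 0 k].

Lemma count_drop_col j mu : count (ltn j) (drop_col mu) = count (ltn j.+1) mu.
Proof. by rewrite count_map; apply: eq_count => -[|a] /=. Qed.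

Lemma col_heightsS k mu : col_heights k.+1 mu = rk mu :: col_heights k (drop_col mu).
Proof.
rewrite /col_heights /= -[1%N]/(1 + 0)%N iotaDl -map_comp; congr (_ :: _).
by apply: eq_map => j /=; rewrite count_drop_col.
Qed.

Lemma leq_rk_drop_col mu : (rk (drop_col mu) <= rk mu)%N.
Proof. by rewrite /rk count_drop_col; apply: sub_count => a /=; case: a. Qed.

Section Residues.
Variables (R : comNzRingType) (p : nat).
Hypothesis p_gt1 : (1 < p)%N.

(** All vectors of representatives for the direct sum of the Z/p^a, a in mu. *)
Fixpoint residues (mu : seq nat) : seq (seq nat) :=
  if mu is a :: mu' then [seq x :: m | x <- iota 0 (p ^ a)%N, m <- residues mu']
  else [:: [::]].

Definition divm (m : seq nat) := [seq (x %/ p)%N | x <- m].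
Fixpoint redm (mu m : seq nat) : seq nat :=
  match mu, m with
  | a :: mu', x :: m' => (x %% p ^ a.-1)%N :: redm mu' m'
  | _, _ => [::]
  end.
Definition pdiv_all (m : seq nat) := all (dvdn p) m.

Lemma sum_iotaM k q (g : nat -> R) :
  \sum_(x <- iota 0 (k * q)%N) g x
  = \sum_(i <- iota 0 k) \sum_(j <- iota 0 q) g (i * q + j)%N.
Proof.
elim: k => [|k IHk]; first by rewrite mul0n /= !big_nil.
rewrite mulSnr iotaD big_cat IHk -[k.+1]addn1 iotaD big_cat /=.
congr (_ + _); rewrite ?big_seq1 add0n.
by rewrite -{1}[(k * q)%N]addn0 iotaDl big_map.
Qed.

Let p_gt0 : (0 < p)%N. Proof. exact: ltnW. Qed.

Lemma sum_mod a (f : nat -> R) :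
  \sum_(x <- iota 0 (p ^ a)%N) f (x %% p ^ a.-1)%N
  = p%:R ^+ (0 < a)%N * \sum_(x <- iota 0 (p ^ a.-1)%N) f x.
Proof.
case: a => [|a] /=; first by rewrite mul1r !big_seq1 modn1.
rewrite expnS sum_iotaM.
transitivity (\sum_(i <- iota 0 p) \sum_(j <- iota 0 (p ^ a)) f j).
  apply: eq_bigr => i _; apply: eq_big_seq => j.
  by rewrite mem_iota => /= lt_j; rewrite modnMDl modn_small.
by rewrite big_const_seq count_predT size_iota iter_addr_0 expr1 mulr_natl.
Qed.

Lemma sum_div a (f : nat -> R) :
  \sum_(x <- iota 0 (p ^ a)%N | (p %| x)%N) f (x %/ p)%N
  = \sum_(x <- iota 0 (p ^ a.-1)%N) f x.
Proof.
case: a => [|a] /=; first by rewrite big_mkcond /= !big_seq1 dvdn0 div0n.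
rewrite expnSr big_mkcond sum_iotaM; apply: eq_bigr => i _.
rewrite -{1}(prednK p_gt0) /= big_cons big_seq big1 => [|j]; last first.
  rewrite mem_iota add1n prednK // => /andP[j0 ltj].
  by rewrite dvdn_addr ?dvdn_mull // gtnNdvd.
by rewrite addn0 dvdn_mull // mulnK // addr0.
Qed.

Lemma sum_mod_div a (f : nat -> R) :
  \sum_(x <- iota 0 (p ^ a)%N | (p %| x)%N) f (x %% p ^ a.-1)%N
  = p%:R ^+ (1 < a)%N * \sum_(x <- iota 0 (p ^ a.-1)%N | (p %| x)%N) f x.
Proof.
case: a => [|[|a]].
- by rewrite mul1r ![LHS]big_mkcond ![in RHS]big_mkcond /= !big_seq1 modn1.
  rewrite mul1r expn1 [RHS]big_mkcond /= big_seq1 dvdn0.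
  rewrite -(prednK p_gt0) /= big_cons dvdn0 big_seq_cond big1 ?modn1 ?addr0 // => j.
  rewrite mem_iota add1n prednK // => /andP[/andP[j0 ltj]].
  by rewrite gtnNdvd.
rewrite big_mkcond [in RHS]big_mkcond.
rewrite -(sum_mod a.+2 (fun x => if (p %| x)%N then f x else 0)).
by apply: eq_bigr => x _; rewrite /= /dvdn modn_dvdm // expnS dvdn_mulr.
Qed.

(** Reduction modulo the exponents of [drop_col mu] is multiplication by p in
    the group of type mu; its fibres have as many elements as the p-torsion,
    p ^ rk mu. *)
Lemma sum_redm mu (F : seq nat -> R) :
  \sum_(m <- residues mu) F (redm mu m)
  = p%:R ^+ rk mu * \sum_(m <- residues (drop_col mu)) F m.
Proof.
elim: mu F => [|a mu IHmu] F; first by rewrite /= mul1r !big_seq1.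
rewrite /= !big_allpairs_dep /= exprD -mulrA [X in _ * X]mulrC mulrA -sum_mod.
rewrite mulr_suml; apply: eq_bigr => x _.
by rewrite (IHmu (fun m => F (_ :: m))) mulrC.
Qed.

(** The vectors divisible by p form a group of type [drop_col mu]. *)
Lemma sum_divm mu (F : seq nat -> R) :
  \sum_(m <- residues mu | pdiv_all m) F (divm m)
  = \sum_(m <- residues (drop_col mu)) F m.
Proof.
elim: mu F => [|a mu IHmu] F; first by rewrite big_mkcond /= !big_seq1.
rewrite big_mkcond /= !big_allpairs_dep /= -sum_div [RHS]big_mkcond /=.
apply: eq_bigr => x _; case: ifP => [px|npx]; last by rewrite big1 // npx.
by rewrite -(IHmu (fun m => F (_ :: m))) [RHS]big_mkcond.
Qed.

(** Inside p M, for M of type mu, a fibre of multiplication by p is either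
    empty or a coset of the p-torsion of p M. *)
Lemma sum_redm_div mu (F : seq nat -> R) :
  \sum_(m <- residues mu | pdiv_all m) F (redm mu m)
  = p%:R ^+ rk (drop_col mu) * \sum_(m <- residues (drop_col mu) | pdiv_all m) F m.
Proof.
elim: mu F => [|a mu IHmu] F.
  by rewrite mul1r ![LHS]big_mkcond ![in RHS]big_mkcond /= !big_seq1.
rewrite big_mkcond [in RHS]big_mkcond /= !big_allpairs_dep /= exprD -mulrA [X in _ * X]mulrC.
have -> : (0 < a.-1)%N = (1 < a)%N by case: a => [|[]].
under [X in _ * (X * _)]eq_bigr => x _.
  rewrite (_ : \sum_(_ <- _) _ = if (p %| x)%N
      then \sum_(m <- residues (drop_col mu) | pdiv_all m) F (x :: m) else 0).
    over.
  by case: ifP => px; [rewrite [RHS]big_mkcond | rewrite big1 // ].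
rewrite -big_mkcond mulrA -sum_mod_div mulr_suml [RHS]big_mkcond /=.
apply: eq_bigr => x _; case: ifP => px; last by rewrite big1 // ?px.
by rewrite mulrC -(IHmu (fun m => F (_ :: m))) [RHS]big_mkcond.
Qed.

Section Weights.
Variables (X : nat -> R) (y : R).

(** The weight X^mu of the lattice ext d h M, for M of type mu and h with
    residue vector m, if it contains p^k times everything, and 0 otherwise. The
    recursion removes the first column; [ext_weightE] proves that this is what
    the function computes. *)
Fixpoint ext_weight k (mu m : seq nat) d : R :=
  if k is k'.+1 then
    if (0 < d)%N && pdiv_all m then X (rk mu).+1 * ext_weight k' (drop_col mu) (divm m) d.-1
    else X (rk mu) * ext_weight k' (drop_col mu) (redm mu m) d
  else ((d == 0) && all (pred1 0%N) mu)%:R.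

Lemma ext_weight_gt k mu m d : (k < d)%N -> ext_weight k mu m d = 0.
Proof.
elim: k mu m d => [|k IHk] mu m d; first by case: d.
move=> lt_kd /=; case: ifP => _; rewrite IHk ?mulr0 //; first by case: d lt_kd.
exact: ltnW.
Qed.

(** The generating function of the extensions of M that contain p^k times
    everything, and its part in which the first column is higher than that
    of M. *)
Definition ext_gf k mu :=
  \sum_(d <- iota 0 k.+1) \sum_(m <- residues mu) y ^+ d * ext_weight k mu m d.
Definition ext_gf_box k mu :=
  \sum_(d <- iota 1 k) \sum_(m <- residues mu | pdiv_all m) y ^+ d * ext_weight k mu m d.

(** A new box in the first column means that h is divisible by p; then h / p
    and d - 1 are arbitrary. *)
Lemma ext_gf_boxS k mu : ext_gf_box k.+1 mu = up X y (rk mu) * ext_gf k (drop_col mu).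
Proof.
rewrite /ext_gf_box (iotaDl 1 0) big_map /ext_gf big_distrr.
apply: eq_bigr => d _ /=; rewrite mulr_sumr -sum_divm.
apply: eq_bigr => m pm; rewrite pm add1n /= exprS /up; ring.
Qed.

(** If there is no new box in the first column then h is reduced modulo the set
    of all b with p b in M, with fibres of size p ^ rk mu. For d > 0 the vectors
    h divisible by p are to be excluded; these lie over vectors that are
    divisible by p again, which is why only [ext_gf_box] is subtracted. *)
Lemma ext_gfS k mu : ext_gf k.+1 mu
  = ext_gf_box k.+1 mu
    + X (rk mu) * (p%:R ^+ rk mu * ext_gf k (drop_col mu)
                   - p%:R ^+ rk (drop_col mu) * ext_gf_box k (drop_col mu)).
Proof.
have cut i (f : nat -> R) : f (i + k.+1)%N = 0 ->
    \sum_(d <- iota i k.+2) f d = \sum_(d <- iota i k.+1) f d.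
  move=> f0; rewrite -(addn1 k.+1) iotaD big_cat -[RHS]addr0; congr (_ + _).
  by rewrite big_seq1.
have cut1 (f : nat -> R) : f k.+1 = 0 ->
    \sum_(d <- iota 1 k.+1) f d = \sum_(d <- iota 1 k) f d.
  move=> f0; rewrite -(addn1 k) iotaD big_cat -[RHS]addr0; congr (_ + _).
  by rewrite big_seq1 -f0 add1n.
pose w d m := y ^+ d * ext_weight k (drop_col mu) m d.
have -> : p%:R ^+ rk mu * ext_gf k (drop_col mu)
    = \sum_(d <- iota 0 k.+2) \sum_(m <- residues mu) w d (redm mu m).
  rewrite cut; last by rewrite big1 // => m _; rewrite /w ext_weight_gt ?mulr0.
  by rewrite mulr_sumr; apply: eq_bigr => d _; rewrite sum_redm.
have -> : p%:R ^+ rk (drop_col mu) * ext_gf_box k (drop_col mu)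
    = \sum_(d <- iota 1 k.+1) \sum_(m <- residues mu | pdiv_all m) w d (redm mu m).
  rewrite cut1; last by rewrite big1 // => m _; rewrite /w ext_weight_gt ?mulr0.
  by rewrite mulr_sumr; apply: eq_bigr => d _; rewrite sum_redm_div.
have hd (f : nat -> R) :
    \sum_(d <- iota 0 k.+2) f d = f 0%N + \sum_(d <- iota 1 k.+1) f d.
  by rewrite (iotaD 0 1) big_cat big_seq1.
rewrite /ext_gf /ext_gf_box !hd -addrA mulrDr addrCA mulr_sumr; congr (_ + _).
  by apply: eq_bigr => m _; rewrite /w /= mulrCA.
rewrite -sumrB mulr_sumr -big_split.
apply: eq_big_seq => d; rewrite mem_iota => /andP[d0 _] /=.
rewrite [in X in _ + _ * (X - _)](bigID pdiv_all) /= addrAC subrr add0r.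
rewrite (bigID pdiv_all) /= mulr_sumr; congr (_ + _).
by apply: eq_bigr => m npm; rewrite d0 (negbTE npm) /w /= mulrCA.
Qed.

End Weights.
End Residues.

(** * Transfer matrices and their diagonalisation *)

Section Walk.
Variable R : comNzRingType.
Variables (T y : R) (X : nat -> R).
Implicit Types (e : nat -> nat) (v w : R * R) (s : seq bool).

(** States are pairs (extensions with a box in the next column, extensions
    without). [col_step] is the effect of one column of height r, and
    [height_step] of going from one height to the next, multiplied by T. *)
Definition col_step r v := (up X y r * (v.1 + v.2), lo T X r * v.2).
Definition height_step v := (v.1, (T - 1) * v.1 + T * v.2).

(** [e r] columns of height r for each r, starting from the state [w] at the
    far end, where the remaining columns have height 0. *)
Fixpoint transfer e w r :=
  iter (e r) (col_step r) (if r is r'.+1 then height_step (transfer e w r') else w).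

Lemma eq_transfer e e' w r :
  (forall i, (i <= r)%N -> e i = e' i) -> transfer e w r = transfer e' w r.
Proof.
elim: r => [|r IHr] eqe /=; rewrite eqe //.
by rewrite IHr // => i le_ir; rewrite eqe // leqW.
Qed.

Lemma transfer_col_step e w r :
  transfer (fun i => (i == r) + e i)%N w r = col_step r (transfer e w r).
Proof.
case: r => [|r] //=; rewrite eqxx add1n iterS.
congr (col_step _ (iter _ _ (height_step _))).
by apply: eq_transfer => i le_ir; rewrite ltn_eqF.
Qed.

Lemma iter_height_step c v :
  iter c height_step v = (v.1, (T ^+ c - 1) * v.1 + T ^+ c * v.2).
Proof.
elim: c => [|c IHc]; first by case: v => a b /=; rewrite subrr mul0r add0r mul1r.
by rewrite iterS IHc /height_step /=; congr (_, _); rewrite exprS; ring.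
Qed.

Lemma transfer_height_step e w r c :
  (forall i, (r < i)%N -> e i = 0%N) ->
  transfer e w (c + r) = iter c height_step (transfer e w r).
Proof.
by move=> e0; elim: c => //= c <-; rewrite e0 // ltnS leq_addl.
Qed.

Lemma transfer_lin e w w' a b r :
  transfer e (a * w.1 + b * w'.1, a * w.2 + b * w'.2) r
  = (a * (transfer e w r).1 + b * (transfer e w' r).1,
     a * (transfer e w r).2 + b * (transfer e w' r).2).
Proof.
have growL m i v v' : iter m (col_step i) (a * v.1 + b * v'.1, a * v.2 + b * v'.2)
    = (a * (iter m (col_step i) v).1 + b * (iter m (col_step i) v').1,
       a * (iter m (col_step i) v).2 + b * (iter m (col_step i) v').2).
  elim: m => //= m ->; rewrite /col_step /=; congr (_, _); ring.
elim: r => [|r IHr] /=; first exact: growL.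
by rewrite IHr -growL /height_step /=; congr (iter _ _ (_, _)); ring.
Qed.

(** Eigenvectors of [col_step] for the eigenvalues [up r] (true bit) and
    [lo r]; the pairing of the row with the column is the gap lo r - up r. *)
Definition eigen_row (b : bool) r v :=
  if b then (lo T X r - up X y r) * v.1 - up X y r * v.2 else v.2.
Definition eigen_col (b : bool) r : R * R :=
  if b then (1, 0) else (up X y r, lo T X r - up X y r).

Lemma col_step_spectral m r v : let g := lo T X r - up X y r in
  (g * (iter m (col_step r) v).1, g * (iter m (col_step r) v).2)
  = (up X y r ^+ m * eigen_row true r v * (eigen_col true r).1
       + lo T X r ^+ m * eigen_row false r v * (eigen_col false r).1,
     up X y r ^+ m * eigen_row true r v * (eigen_col true r).2
       + lo T X r ^+ m * eigen_row false r v * (eigen_col false r).2).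
Proof.
rewrite /=; elim: m => [|m IHm] /=; first by congr (_, _); ring.
case: IHm; set a := (iter _ _ _).1; set b := (iter _ _ _).2 => ea eb.
congr (_, _); rewrite exprS.
  transitivity (up X y r * ((lo T X r - up X y r) * a + (lo T X r - up X y r) * b)).
    by ring.
  by rewrite ea eb exprS; ring.
transitivity (lo T X r * ((lo T X r - up X y r) * b)); first by ring.
by rewrite eb exprS; ring.
Qed.

Lemma linkE r b b' : link T X y r.+1 b b' = eigen_row b r.+1 (height_step (eigen_col b' r)).
Proof. by case: b; case: b' => /=; ring. Qed.

Definition branch_monomial e s r := \prod_(i < r) subst_vars T X y s i.+1 ^+ e i.+1.

(** Starting from the eigenvector for the eigenvalue lo 0 = 1 avoids a choice at
    height 0; each further height splits every term in two. *)
Lemma transfer_spectral e r : lo T X 0 = 1 ->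
  let g := \prod_(i < r) (lo T X i.+1 - up X y i.+1) in
  let w := transfer e (eigen_col false 0) r in
  (g * w.1, g * w.2)
  = (\sum_(s <- bits r) links T X y s * branch_monomial e s r
       * (eigen_col (head false s) r).1,
     \sum_(s <- bits r) links T X y s * branch_monomial e s r
       * (eigen_col (head false s) r).2).
Proof.
move=> lo0; elim: r => [|r IHr].
  rewrite /= /branch_monomial !big_ord0 !big_seq1 /= !mul1r /branch_monomial big_ord0 !mul1r.
  have -> : iter (e 0%N) (col_step 0) (up X y 0, lo T X 0 - up X y 0)
            = (up X y 0, lo T X 0 - up X y 0).
    elim: (e 0%N) => //= m ->; rewrite /col_step lo0 /=; congr (_, _); ring.
  by [].
case: IHr => /=; set g := \prod_(_ < _) _; set w := transfer _ _ _ => IH1 IH2.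
rewrite big_ord_recr /= -/g.
have rowS b : g * eigen_row b r.+1 (height_step w) = \sum_(s <- bits r)
    links T X y s * branch_monomial e s r * link T X y r.+1 b (head false s).
  transitivity (eigen_row b r.+1 (height_step (g * w.1, g * w.2))).
    by case: b => /=; ring.
  rewrite IH1 IH2; under [RHS]eq_bigr => s _ do rewrite linkE.
  by case: b; rewrite /= !(mulr_sumr, =^~ mulr_suml, =^~ big_split, =^~ sumrB) /=;
     apply: eq_bigr => s _; ring.
have [E1 E2] := col_step_spectral (e r.+1) r.+1 (height_step w).
have step f : g * (up X y r.+1 ^+ e r.+1 * eigen_row true r.+1 (height_step w) * f true
       + lo T X r.+1 ^+ e r.+1 * eigen_row false r.+1 (height_step w) * f false)
   = \sum_(s <- bits r.+1) links T X y s * branch_monomial e s r.+1 * f (head false s).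
  rewrite sum_bitsS big_split /=.
  have monS b s : s \in bits r ->
      branch_monomial e (b :: s) r.+1 = branch_monomial e s r * branch T X y b r.+1 ^+ e r.+1.
    move=> /size_bits sr; rewrite /branch_monomial big_ord_recr /=; congr (_ * _).
      by apply: eq_bigr => i _; rewrite /subst_vars bit_cons // sr.
    by rewrite /subst_vars /= sr eqxx.
  transitivity (up X y r.+1 ^+ e r.+1 * f true * (g * eigen_row true r.+1 (height_step w))
     + lo T X r.+1 ^+ e r.+1 * f false * (g * eigen_row false r.+1 (height_step w))).
    by rewrite /eigen_row /=; ring.
  rewrite !rowS !mulr_sumr; congr (_ + _); apply: eq_big_seq => s sP;
    rewrite monS //= (size_bits sP) /=; ring.
congr (_, _); first by rewrite -mulrA E1 (step (fun b => (eigen_col b r.+1).1)).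
by rewrite -mulrA E2 (step (fun b => (eigen_col b r.+1).2)).
Qed.

Lemma transfer_coef e r : lo T X 0 = 1 ->
  let w := transfer e (eigen_col false 0) r in
  \prod_(i < r) (lo T X i.+1 - up X y i.+1) * (w.1 + w.2)
  = \sum_(s <- bits r) branch_coef T X y s * branch_monomial e s r.
Proof.
move=> lo0 w; case: (transfer_spectral e r lo0); rewrite -/w => E1 E2.
rewrite mulrDr E1 E2 -big_split /=; apply: eq_big_seq => s /size_bits <-.
by rewrite /branch_coef; case: (head false s) => /=; ring.
Qed.

(** The state (0, 1) in which all columns are used up is a combination of
    (1, 0), whose contribution has high order, and the eigenvector at
    height 0. *)
Lemma transfer_start e r : lo T X 0 = 1 ->
  let w := transfer e (0, 1) r in let w0 := transfer e (eigen_col false 0) r in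
  let w1 := transfer e (1, 0) r in
  (1 - up X y 0) * (w.1 + w.2) = (w0.1 + w0.2) - up X y 0 * (w1.1 + w1.2).
Proof.
move=> lo0 w w0 w1.
have := transfer_lin e (0, 1) (1, 0) (1 - up X y 0) (up X y 0) r.
rewrite /= !(mulr0, mulr1, add0r, addr0).
rewrite -[X in (_, X - _)]lo0 -/(eigen_col false 0) -/w0 => ->.
by rewrite /= -/w -/w1; ring.
Qed.

End Walk.

Section GenWalk.
Variables (R : comNzRingType) (p : nat) (X : nat -> R) (y : R).
Hypotheses (p_gt1 : (1 < p)%N) (X0 : X 0%N = 1).
Let T : R := p%:R.
Notation ext_gf := (ext_gf p X y).
Notation ext_gf_box := (ext_gf_box p X y).

Definition height_mult k mu i := count_mem i (col_heights k mu).

Lemma heights_leq_rk k mu c : c \in col_heights k mu -> (c <= rk mu)%N.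
Proof.
case/mapP=> j _ ->; apply: sub_count => a /=; exact: leq_trans.
Qed.

(** Since [ext_gfS] refers to the height of the next column, a column of height
    r followed by one of height r' acts by [col_step] after r - r' times
    [height_step], up to the factor T^(r - r'). *)
Lemma ext_gf_transfer k mu : all (leq^~ k) mu ->
  (T ^+ rk mu * ext_gf_box k mu, T ^+ rk mu * (ext_gf k mu - ext_gf_box k mu))
  = transfer T y X (height_mult k mu) (0, 1) (rk mu).
Proof.
elim: k mu => [|k IHk] mu le_mu.
  have mu0 : all (pred1 0%N) mu by apply: sub_all le_mu => a; rewrite /= leqn0.
  have rk0 : rk mu = 0%N.
    by apply/eqP; rewrite -leqn0 leqNgt -has_count; apply/hasPn => a /(allP mu0)/= /eqP->.
  rewrite rk0 /ext_gf_box big_nil /ext_gf big_seq1 /= mu0 !mul1r subr0.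
  rewrite big_const_seq count_predT iter_addr_0.
  suff -> : size (residues p mu) = 1%N by [].
  elim: mu mu0 {le_mu rk0} => //= a mu IHmu /andP[/eqP-> /IHmu]; rewrite expn0 /= cats0.
  by rewrite size_map.
have le_dec : all (leq^~ k) (drop_col mu).
  by rewrite all_map; apply: sub_all le_mu => -[|a].
have {IHk} := IHk _ le_dec; set w := transfer _ _ _ _ _ _ => IHk.
have walkE : transfer T y X (height_mult k.+1 mu) (0, 1) (rk mu)
    = col_step T y X (rk mu) (iter (rk mu - rk (drop_col mu)) (height_step T) w).
  rewrite -transfer_height_step; last first.
    by move=> i lt_i; apply/count_memPn/negP => /heights_leq_rk; rewrite leqNgt lt_i.
  rewrite subnK ?leq_rk_drop_col // -transfer_col_step; apply: eq_transfer => i _.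
  by rewrite /height_mult col_heightsS /= eq_sym.
rewrite walkE iter_height_step -IHk /col_step /= ext_gfS // !ext_gf_boxS // /lo /up -/T.
rewrite addrAC subrr add0r.
have -> : T ^+ rk mu = T ^+ (rk mu - rk (drop_col mu)) * T ^+ rk (drop_col mu).
  by rewrite -exprD subnK // leq_rk_drop_col.
set b := ext_gf_box _ _; set g := ext_gf _ _.
by congr (_, _); ring.
Qed.

Definition type_weight (Z : nat -> R) k mu := \prod_(c <- col_heights k mu) Z c.

Lemma prod_count (Z : nat -> R) n (s : seq nat) : all (leq^~ n) s ->
  \prod_(c <- s) Z c = \prod_(i < n.+1) Z i ^+ count_mem (val i) s.
Proof.
elim: s => [|c s IHs] /=; first by rewrite big_nil big1.
case/andP=> le_cn le_sn; rewrite big_cons IHs //.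
have {1}-> : Z c = \prod_(i < n.+1) Z i ^+ (c == i).
  rewrite (bigD1 (Ordinal (le_cn : c < n.+1)%N)) //= eqxx big1 ?mulr1 // => i ne_ic.
  by rewrite (_ : (c == i) = false) //; apply: contraNF ne_ic => /eqP ci; apply/eqP/val_inj.
by rewrite -big_split; apply: eq_bigr => i _; rewrite exprD.
Qed.

(** The subtracted term comes from cutting the geometric series at k columns;
    by [ordge_transfer] its order exceeds k. *)
Lemma gaps_ext_gf k mu : all (leq^~ k) mu ->
  let n := size mu in
  let w := transfer T y X (height_mult k mu) (1, 0) n in
  gaps T X y n * ext_gf k mu
  = \sum_(s <- bits n) branch_coef T X y s * type_weight (subst_vars T X y s) k mu
    - \prod_(i < n) (lo T X i.+1 - up X y i.+1) * (up X y 0 * (w.1 + w.2)).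
Proof.
move=> le_mu n w.
have lo0 : lo T X 0 = 1 by rewrite /lo X0 mulr1.
have le_rk : (rk mu <= n)%N by exact: count_size.
have E : T ^+ n * ext_gf k mu = (transfer T y X (height_mult k mu) (0, 1) n).1
                           + (transfer T y X (height_mult k mu) (0, 1) n).2.
  rewrite -(subnK le_rk) transfer_height_step; last first.
    by move=> i lt_i; apply/count_memPn/negP => /heights_leq_rk; rewrite leqNgt lt_i.
  by rewrite -ext_gf_transfer // iter_height_step /= exprD; ring.
transitivity (\prod_(i < n) (lo T X i.+1 - up X y i.+1)
   * ((1 - up X y 0) * (T ^+ n * ext_gf k mu))).
  by rewrite /gaps big_ord_recl /= lo0; ring.
rewrite E transfer_start // mulrBr transfer_coef //; congr (_ - _).
apply: eq_big_seq => s sP; congr (_ * _).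
rewrite /type_weight (@prod_count _ n); last first.
  by apply/allP => c /heights_leq_rk /= le_c; apply: leq_trans le_c le_rk.
by rewrite big_ord_recl /= subst0 X0 expr1n mul1r.
Qed.

End GenWalk.

(** * Truncation by degree *)

Section Order.
Variable N : nat.
Local Notation P := {mpoly int[N]}.
Implicit Types p q : P.

(** The polynomials of order at least k, that is, the congruence modulo terms
    of degree at least k. *)
Definition ordge k p := forall m : 'X_{1.. N}, (mdeg m < k)%N -> p@_m = 0.

Lemma ordgeD k p q : ordge k p -> ordge k q -> ordge k (p + q).
Proof. by move=> op oq m lt_m; rewrite mcoeffD op // oq // addr0. Qed.
Lemma ordgeN k p : ordge k p -> ordge k (- p).
Proof. by move=> op m lt_m; rewrite mcoeffN op // oppr0. Qed.
Lemma ordgeM j k p q : ordge j p -> ordge k q -> ordge (j + k) (p * q).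
Proof.
move=> op oq m lt_m; rewrite mcoeffM big1 // => -[a b] /= /eqP mE.
have [lt_a|le_a] := ltnP (mdeg a) j; first by rewrite op // mul0r.
have := congr1 (@mdeg N) mE; rewrite mdegD => degE.
by rewrite oq ?mulr0 //; move: lt_m degE le_a; lia.
Qed.
Lemma ordgeMl k p q : ordge k p -> ordge k (q * p).
Proof. by move=> op; rewrite -[k]add0n; apply: ordgeM. Qed.
Lemma ordge_sum k (I : eqType) (r : seq I) (F : I -> P) :
  (forall i, i \in r -> ordge k (F i)) -> ordge k (\sum_(i <- r) F i).
Proof.
move=> oF; rewrite big_seq; elim/big_ind: _ => //; last exact: ordgeD.
by move=> m _; rewrite mcoeff0.
Qed.

Variables (T y : P) (X : nat -> P).
Hypothesis oX : forall i, ordge 1 (X i.+1).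

Lemma ordge_up r : ordge 1 (up X y r).
Proof. exact: ordgeMl. Qed.
Lemma ordge_lo r : ordge 1 (lo T X r.+1).
Proof. exact: ordgeMl. Qed.

Lemma ordge_iter_col_step i j m v : (0 < i)%N -> ordge j v.1 -> ordge j v.2 ->
  ordge (m + j) (iter m (col_step T y X i) v).1
  /\ ordge (m + j) (iter m (col_step T y X i) v).2.
Proof.
case: i => // i _ o1 o2; elim: m => //= m [IH1 IH2].
by rewrite addSn -add1n; split; apply: ordgeM;
  [exact: ordge_up | exact: ordgeD | exact: ordge_lo | ].
Qed.

(** Each column multiplies by some [up] or [lo], of order at least 1. At height
    0, where lo 0 = 1 has order 0, the second component stays 0. *)
Lemma ordge_transfer e n :
  let w := transfer T y X e (1, 0) n in
  ordge (\sum_(i < n.+1) e i) w.1 /\ ordge (\sum_(i < n.+1) e i) w.2.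
Proof.
elim: n => [|n [IH1 IH2]] /=.
  rewrite big_ord1; suff: ordge (e 0%N) (iter (e 0%N) (col_step T y X 0) (1, 0)).1
      /\ (iter (e 0%N) (col_step T y X 0) (1, 0)).2 = 0.
    by move=> [? ->]; split => // m _; rewrite mcoeff0.
  elim: (e 0%N) => //= m [IH1 ->]; rewrite mulr0 addr0; split=> //.
  by rewrite -add1n; apply: ordgeM => //; apply: ordge_up.
rewrite big_ord_recr /= addnC; apply: ordge_iter_col_step => //=.
by apply: ordgeD; apply: ordgeMl.
Qed.

End Order.

Lemma sum_count (s : seq nat) n : all (leq^~ n) s ->
  (\sum_(i < n.+1) count_mem (val i) s)%N = size s.
Proof.
elim: s => [|c s IHs] /=; first by rewrite big1.
case/andP=> le_cn le_sn; rewrite big_split /= IHs //.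
rewrite (bigD1 (Ordinal (le_cn : c < n.+1)%N)) //= eqxx big1 // => i ne_ic.
by rewrite (_ : (c == i) = false) //; apply: contraNF ne_ic => /eqP ci; apply/eqP/val_inj.
Qed.

Lemma gaps_ext_gf_trunc N p (X : nat -> {mpoly int[N]}) (y : {mpoly int[N]}) k mu :
  (1 < p)%N -> X 0%N = 1 -> (forall i, ordge 1 (X i.+1)) -> all (leq^~ k) mu ->
  ordge k.+1 (gaps p%:R X y (size mu) * ext_gf p X y k mu
    - \sum_(s <- bits (size mu))
        branch_coef p%:R X y s * type_weight (subst_vars p%:R X y s) k mu).
Proof.
move=> p_gt1 X0 oX le_mu; rewrite gaps_ext_gf //= addrAC subrr add0r.
have le_rk : (rk mu <= size mu)%N by exact: count_size.
apply/ordgeN/ordgeMl; rewrite -add1n; apply: ordgeM; first exact: ordge_up.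
have := ordge_transfer p%:R y oX (height_mult k mu) (size mu).
rewrite sum_count ?size_map ?size_iota; last first.
  by apply/allP => c /heights_leq_rk /= le_c; apply: leq_trans le_c le_rk.
by case=> o1 o2; apply: ordgeD.
Qed.

(** * Arithmetic of p-adic integers *)

Section Padic.
Variable p : nat.
Hypothesis p_gt1 : (1 < p)%N.
Local Notation Zp := (padic_int p).
Implicit Types x y : Zp.

Lemma residueD x y k : residue (x + y) k = ((residue x k + residue y k) %% (p ^ k)%N)%Z.
Proof. by []. Qed.
Lemma residueM x y k : residue (x * y) k = ((residue x k * residue y k) %% (p ^ k)%N)%Z.
Proof. by []. Qed.
Lemma residueN x k : residue (- x) k = ((- residue x k) %% (p ^ k)%N)%Z.
Proof. by []. Qed.

Lemma residue_int (a : int) k : residue (a%:~R : Zp) k = (a %% (p ^ k)%N)%Z.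
Proof.
have nat_case n : residue (n%:R : Zp) k = (n%:Z %% (p ^ k)%N)%Z.
  elim: n => [|n IHn]; first by [].
  by rewrite -natr1 residueD IHn modzDml modzDmr intS addrC.
case: a => n; first exact: nat_case.
by rewrite NegzE mulrNz residueN nat_case modzNm.
Qed.

(** The coherence of residues, for levels that are not consecutive. *)
Lemma residue_congr x j k : (j <= k)%N -> (residue x k = residue x j %[mod (p ^ j)%N])%Z.
Proof.
move=> /subnK <-; elim: (k - j)%N => // i IHi.
rewrite -IHi addSn [in RHS]residueK.
rewrite [in LHS](divz_eq (residue x (i + j).+1) (p ^ (i + j))%N).
by rewrite expnD PoszM mulrA modzMDl.
Qed.

Lemma residue_expM k y : residue (p%:R ^+ k * y) k = 0.
Proof.
rewrite residueM -natrX -[_%:R]/((Posz (p ^ k))%:~R) residue_int modzz mul0r.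
exact: mod0z.
Qed.

Lemma padic_div x k : residue x k = 0 -> exists y, x = p%:R ^+ k * y.
Proof.
move=> x0; pose f j := (residue x (j + k) %/ (p ^ k)%N)%Z.
have fK j : residue x (j + k) = f j * (p ^ k)%N.
  have := divz_eq (residue x (j + k)) (p ^ k)%N.
  by rewrite (residue_congr x (leq_addl j k)) x0 mod0z addr0.
have pk0 : ((p ^ k)%N : int) != 0 by rewrite -lt0n expn_gt0 ltnW.
have fP j : (f j = f j.+1 %[mod (p ^ j)%N])%Z.
  apply/eqP; rewrite eqz_mod_dvd -(dvdz_mul2r pk0) mulrBl -!fK -PoszM -expnD.
  rewrite -eqz_mod_dvd; apply/eqP; exact: residueS.
exists (padic_of fP); apply: padicP => j.
rewrite residueM -natrX -[_%:R]/((Posz (p ^ k))%:~R) residue_int modzMml /=.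
rewrite modzMmr mulrC -fK (residue_congr x (leq_addr k j)).
by rewrite residue_mod.
Qed.

Lemma padic_split x k : exists y, x = (residue x k)%:~R + p%:R ^+ k * y.
Proof.
have [|y xE] := @padic_div (x - (residue x k)%:~R) k; last first.
  by exists y; rewrite -xE addrC subrK.
by rewrite residueD residueN residue_int residue_mod modzDmr subrr mod0z.
Qed.

Lemma mul_expI k : injective (fun y : Zp => p%:R ^+ k * y).
Proof.
move=> y z /= eq_yz; apply: padicP => j.
have := congr1 (fun x => residue x (j + k)) eq_yz.
rewrite !residueM -natrX -[_%:R]/((Posz (p ^ k))%:~R) residue_int !modzMml => /eqP.
rewrite eqz_mod_dvd -mulrBr expnD PoszM [Posz (p ^ j) * _]mulrC dvdz_mul2l; last first.
  by rewrite -lt0n expn_gt0 ltnW.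
rewrite -eqz_mod_dvd => /eqP.
by rewrite !(residue_congr _ (leq_addr k j)) !residue_mod.
Qed.

(** The inverse is the sum of the geometric series in p ^ c. *)
Lemma padic_geom_unit c : (0 < c)%N -> exists z : Zp, z * (1 - p%:R ^+ c) = 1.
Proof.
move=> c0; pose f k := \sum_(i < k) (Posz (p ^ c)) ^+ i.
have dvd_pck k : ((p ^ k)%N %| (Posz (p ^ c)) ^+ k)%Z.
  rewrite -[Posz (p ^ c)]natz -natrX natz dvdzE /= -expnM dvdn_exp2l //.
  by rewrite leq_pmull.
have fP k : (f k = f k.+1 %[mod (p ^ k)%N])%Z.
  apply/eqP; rewrite eqz_mod_dvd /f big_ord_recr /= opprD addrA subrr add0r rpredN; exact: dvd_pck.
exists (padic_of fP); apply: padicP => k.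
rewrite residueM [residue (padic_of _) _]/= modzMml residueD residueN -natrX -[_%:R]/((Posz _)%:~R).
rewrite -[1]/(1%:~R) !residue_int modzNm modzDm modzMmr.
have -> : f k * (1 - Posz (p ^ c)) = 1 - (Posz (p ^ c)) ^+ k.
  by rewrite mulrC -[in RHS](expr1n _ k) subrXX; congr (_ * _); apply: eq_bigr => i _;
     rewrite expr1n mul1r.
apply/eqP; rewrite eqz_mod_dvd addrAC subrr add0r rpredN; exact: dvd_pck.
Qed.

End Padic.

(** * Finite index and levels *)

Section Sublattices.
Variable p : nat.
Hypothesis p_gt1 : (1 < p)%N.
Local Notation Zp := (padic_int p).
Local Open Scope classical_set_scope.

Section Dim.
Variable n : nat.
Implicit Types (L : set 'rV[Zp]_n) (u v : 'rV[Zp]_n).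

Lemma sublatticeP L : sublattice L <->
  L 0 /\ forall a u v, L u -> L v -> L (a *: u + v).
Proof.
split=> -[L0 LP]; split; first by move: L0; rewrite inE.
- by move=> a u v Lu Lv; have := LP a u v; rewrite !inE; apply.
- by rewrite inE.
by move=> a u v; rewrite !inE; apply: LP.
Qed.

Section Closure.
Variable L : set 'rV[Zp]_n.
Hypothesis latL : sublattice L.

Lemma lat0 : L 0. Proof. by have /sublatticeP[] := latL. Qed.
Lemma latD u v : L u -> L v -> L (u + v).
Proof. by have /sublatticeP[_ LP] := latL; rewrite -{2}[u]scale1r; apply: LP. Qed.
Lemma latZ a u : L u -> L (a *: u).
Proof.
by have /sublatticeP[L0 LP] := latL; rewrite -[_ *: _]addr0 => Lu; apply: LP.
Qed.
Lemma latN u : L u -> L (- u).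
Proof. by rewrite -scaleN1r; apply: latZ. Qed.
Lemma latB u v : L u -> L v -> L (u - v).
Proof. by move=> Lu /latN; apply: latD. Qed.
Lemma lat_sum (I : Type) (r : seq I) (F : I -> 'rV[Zp]_n) :
  (forall i, L (F i)) -> L (\sum_(i <- r) F i).
Proof. by move=> LF; elim/big_ind: _ => //; [exact: lat0 | exact: latD]. Qed.
Lemma latDl u v : L u -> L (u + v) <-> L v.
Proof.
move=> Lu; split=> [Luv|]; last exact: latD.
by have := latB Luv Lu; rewrite addrC addKr.
Qed.
End Closure.

(** Containing p^k times everything makes a lattice a matter of residues
    modulo p^k, hence of integer vectors ([level_resv]). *)
Definition level k L := sublattice L /\ forall v, L (p%:R ^+ k *: v).

Definition resv k v : 'rV[int]_n := \row_i residue (v 0 i) k.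
Definition intv (t : 'rV[int]_n) : 'rV[Zp]_n := map_mx intr t.

Lemma resv_split k v : exists w, v = intv (resv k v) + p%:R ^+ k *: w.
Proof.
have /choice[f fP] i := padic_split p_gt1 (v 0 i) k.
by exists (\row_i f i); apply/rowP => i; rewrite !mxE.
Qed.

Lemma level_resv k L v : level k L -> L v <-> L (intv (resv k v)).
Proof.
move=> [latL Lk]; have [w vE] := resv_split k v.
by rewrite {1}vE addrC; apply: latDl.
Qed.

(** If the index is finite, two powers p^i < p^i' of p agree on a basis vector
    modulo L; as 1 - p^(i' - i) is a unit, p^i times this vector is in L. *)
Lemma finite_index_levelP L : sublattice L ->
  finite_index L <-> exists k, level k L.
Proof.
move=> latL; split=> [Lfin|[k [_ Lk]]]; last first.
  pose g (w : 'rV['I_(p ^ k).-1.+1]_n) : set 'rV[Zp]_n :=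
    [set intv (map_mx (fun i : 'I__ => Posz i) w) + u | u in L].
  apply: (@sub_finite_set _ _ (g @` setT)); last exact/finite_image/finite_finset.
  move=> _ [v _ <-].
  have pk0 : (0 < p ^ k)%N by rewrite expn_gt0 ltnW.
  have res_lt (i : 'I_n) : (absz (residue (v ord0 i) k) < (p ^ k).-1.+1)%N.
    rewrite prednK // -residue_mod -ltz_nat gez0_abs ?modz_ge0 ?ltz_pmod //.
    by rewrite -lt0n.
  exists (\row_i Ordinal (res_lt i)) => //.
  have [w vE] := resv_split k v.
  have gE : intv (map_mx (fun i : 'I__ => Posz i) (\row_i Ordinal (res_lt i)))
            = intv (resv k v).
    congr intv; apply/rowP => i; rewrite !mxE /= gez0_abs //.
    by rewrite -residue_mod modz_ge0 // -lt0n.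
  rewrite /g gE; apply/seteqP; split=> _ [u Lu <-].
    exists (u - p%:R ^+ k *: w); first by apply: latB.
    by rewrite {1}vE addrACA subrr addr0.
  exists (u + p%:R ^+ k *: w); first by apply: latD.
  by rewrite {2}vE addrA addrAC.
have axis j : exists i, L (p%:R ^+ i *: delta_mx 0 j).
  apply: contrapT => noL; apply: infinite_nat.
  pose c i := [set (p%:R ^+ i *: delta_mx 0 j : 'rV[Zp]_n) + u | u in L].
  have dist i i' : c i = c i' -> (i < i')%N -> False.
    move=> eqc lt_ii'; apply: noL; exists i.
    have : c i (p%:R ^+ i *: delta_mx 0 j) by exists 0; rewrite ?addr0 //; exact: lat0.
    rewrite eqc => -[u Lu uE].
    have [z zE] := @padic_geom_unit p (i' - i) ltac:(by rewrite subn_gt0).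
    have -> : p%:R ^+ i *: delta_mx 0 j = z *: u.
      rewrite -[LHS]scale1r -[X in X *: _]zE -scalerA; congr (z *: _).
      rewrite scalerBl scale1r scalerA -exprD subnK 1?ltnW // -{1}uE.
      by rewrite addrC addKr.
    exact: latZ.
  have -> : [set: nat] = c @^-1` (c @` setT).
    by apply/seteqP; split=> // i _; exists i.
  apply: finite_preimage.
    move=> i i' _ _ eqc; case: (ltngtP i i') => // /dist; [|move/esym: eqc => eqc];
      by case/(_ eqc).
  by apply: sub_finite_set Lfin => _ [i _ <-]; exists (p%:R ^+ i *: delta_mx 0 j).
have [e eP] := choice axis; exists (\max_j e j)%N; split=> // v.
rewrite [v]row_sum_delta scaler_sumr; apply: lat_sum => // j.
rewrite scalerA mulrC -scalerA -(subnK (leq_bigmax (F := e) j)) exprD -scalerA.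
by do 2![apply: latZ => //].
Qed.

End Dim.
End Sublattices.

(** * Lattices as extensions of their hyperplane section *)

Section Extensions.
Variable p : nat.
Hypothesis p_pr : prime p.
Let p_gt1 : (1 < p)%N. Proof. exact: prime_gt1. Qed.
Local Notation Zp := (padic_int p).
Local Open Scope classical_set_scope.
Variable n : nat.
Implicit Types (L : set 'rV[Zp]_n.+1) (M : set 'rV[Zp]_n).

Definition crow (a : Zp) (b : 'rV[Zp]_n) : 'rV[Zp]_n.+1 :=
  row_mx (a%:M : 'M_1) b.
Definition hd (v : 'rV[Zp]_n.+1) : Zp := v 0 0.
Definition tl (v : 'rV[Zp]_n.+1) : 'rV[Zp]_n := rsubmx (v : 'rV_(1 + n)).

Lemma hd_crow a b : hd (crow a b) = a.
Proof.
by rewrite /hd /crow mxE; case: splitP => [i _|//]; rewrite mxE !ord1 eqxx.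
Qed.
Lemma tl_crow a b : tl (crow a b) = b.
Proof. exact: row_mxKr. Qed.
Lemma crow_hd_tl v : crow (hd v) (tl v) = v.
Proof.
rewrite /crow /tl; have -> : (hd v)%:M = lsubmx (v : 'rV_(1 + n)).
  apply/rowP => i; rewrite !ord1 !mxE eqxx mulr1n /hd; congr (v _ _).
  exact/val_inj.
exact: (@hsubmxK _ 1 1 n v).
Qed.
Lemma hd_lin a u v : hd (a *: u + v) = a * hd u + hd v.
Proof. by rewrite /hd !mxE. Qed.
Lemma tl_lin a u v : tl (a *: u + v) = a *: tl u + tl v.
Proof. by apply/rowP => i; rewrite !mxE. Qed.
Lemma hdZ a u : hd (a *: u) = a * hd u.
Proof. by rewrite /hd !mxE. Qed.
Lemma tlZ a u : tl (a *: u) = a *: tl u.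
Proof. by apply/rowP => i; rewrite !mxE. Qed.

Lemma crow_lin a c b d e : a *: crow c b + crow d e = crow (a * c + d) (a *: b + e).
Proof.
by rewrite -[LHS]crow_hd_tl hd_lin tl_lin !hd_crow !tl_crow.
Qed.
Lemma crowZ a c b : a *: crow c b = crow (a * c) (a *: b).
Proof. by rewrite -[LHS]crow_hd_tl hdZ tlZ hd_crow tl_crow. Qed.
Lemma crow0 : crow 0 0 = 0.
Proof.
rewrite -[RHS]crow_hd_tl; congr crow; first by rewrite /hd mxE.
by apply/rowP => i; rewrite !mxE.
Qed.

(** The lattice spanned by (p^d, h) and by M in the hyperplane x_1 = 0. *)
Definition ext d (h : 'rV[Zp]_n) M : set 'rV[Zp]_n.+1 :=
  [set v | exists c, hd v = c * p%:R ^+ d /\ M (tl v - c *: h)].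
Definition kern L : set 'rV[Zp]_n := [set b | L (crow 0 b)].

Lemma mul_expIr k : injective (fun y : Zp => y * p%:R ^+ k).
Proof. by move=> y z; rewrite ![_ * p%:R ^+ _]mulrC => /mul_expI; apply. Qed.

Lemma ext_sublattice d h M : sublattice M -> sublattice (ext d h M).
Proof.
move=> latM; apply/sublatticeP; split.
  exists 0; rewrite mul0r scale0r subr0 /hd mxE; split=> //.
  rewrite (_ : tl 0 = 0); first exact: lat0.
  by apply/rowP => i; rewrite !mxE.
move=> a u v [c [uE Mu]] [c' [vE Mv]]; exists (a * c + c').
rewrite hd_lin uE vE mulrDl mulrA; split=> //.
rewrite tl_lin scalerDl opprD addrACA -scalerA -scalerBr.
by apply: latD => //; apply: latZ.
Qed.

Lemma kern_ext d h M : kern (ext d h M) = M.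
Proof.
apply/seteqP; split=> b; rewrite /kern /ext /= hd_crow tl_crow.
  case=> c [] /esym c0; rewrite (_ : c = 0) ?scale0r ?subr0 //.
  by apply: (@mul_expIr d); rewrite c0 mul0r.
by move=> Mb; exists 0; rewrite mul0r scale0r subr0.
Qed.

Lemma kern_sublattice L : sublattice L -> sublattice (kern L).
Proof.
move=> latL; apply/sublatticeP; split.
  by rewrite /kern /= crow0; apply: lat0.
move=> a u v Lu Lv; rewrite /kern /= -[0](addr0 0) -{1}[0](mulr0 a) -crow_lin.
by apply: latD => //; apply: latZ.
Qed.

Lemma kern_level k L : level k L -> level k (kern L).
Proof.
move=> [latL Lk]; split; first exact: kern_sublattice.
by move=> v; have := Lk (crow 0 v); rewrite /kern /= crowZ mulr0.
Qed.

(** The first coordinates of L form an ideal that contains p^k; its generator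
    is the least power of p in it, by Bezout applied to residues. *)
Lemma level_ext k L : level k L ->
  exists d h, (d <= k)%N /\ L = ext d h (kern L).
Proof.
move=> [latL Lk]; pose I := [set a | exists b, L (crow a b)].
have I_lin a x y : I x -> I y -> I (a * x + y).
  move=> [b Lb] [b' Lb']; exists (a *: b + b'); rewrite -crow_lin.
  by apply: latD => //; apply: latZ.
have Ik : I (p%:R ^+ k).
  by exists 0; have := Lk (crow 1 0); rewrite crowZ mulr1 scaler0.
have exd : exists d, `[< I (p%:R ^+ d) >] by exists k; apply/asboolP.
have [d /asboolP Id d_min] := ex_minnP exd.
have [h Lh] := Id; exists d, h; split; first by apply: d_min; apply/asboolP.
have I0 : I 0 by have := I_lin (-1) _ _ Ik Ik; rewrite mulN1r addNr.
have I_dvd a : I a -> exists c, a = c * p%:R ^+ d.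
  move=> Ia; have [y aE] := padic_split p_gt1 a d.
  set r := residue a d in aE.
  have Ir : I (r%:~R).
    by have := I_lin (- y) _ _ Id Ia; rewrite aE mulNr [y * _]mulrC addrC addrK.
  have pdE : ((p ^ d)%N : int)%:~R = p%:R ^+ d :> Zp by rewrite -natrX.
  have [u [v uvE]] := Bezoutz r (p ^ d)%N.
  have [e le_ed gE] : exists2 e, (e <= d)%N & gcdz r (p ^ d)%N = (p ^ e)%N.
    have /(dvdn_pfactor _ _ p_pr)[e le_ed gE] := dvdn_gcdr `|r|%N (p ^ d).
    by exists e => //; rewrite -gE.
  have Ie : I (p%:R ^+ e).
    rewrite -natrX -[_%:R]/((Posz (p ^ e))%:~R) -gE -uvE rmorphD !rmorphM /= pdE.
    by rewrite -[_ * p%:R ^+ d]addr0; do 2![apply: (I_lin _ _ _) => //].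
  have de : d = e by apply/eqP; rewrite eqn_leq le_ed d_min //; apply/asboolP.
  have r0 : r = 0.
    rewrite /r -residue_mod; apply/dvdz_mod0P; rewrite -/r.
    by rewrite [in Posz _]de -gE dvdz_gcdl.
  by exists y; rewrite aE r0 add0r mulrC.
apply/seteqP; split=> v.
  move=> Lv; have [c vE] : exists c, hd v = c * p%:R ^+ d.
    by apply: I_dvd; exists (tl v); rewrite crow_hd_tl.
  exists c; split=> //; rewrite /kern /=.
  rewrite (_ : crow _ _ = - c *: crow (p%:R ^+ d) h + v).
    by apply: latD => //; apply: latZ.
  by rewrite -{2}[v]crow_hd_tl crow_lin vE mulNr addNr scaleNr addrC.
move=> [c [vE Lv]]; rewrite -[v]crow_hd_tl vE.
rewrite (_ : crow _ _ = c *: crow (p%:R ^+ d) h + crow 0 (tl v - c *: h)).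
  by apply: latD => //; apply: latZ.
by rewrite crow_lin addr0 addrC subrK.
Qed.

Lemma ext_inj d h M d' h' M' : sublattice M -> sublattice M' ->
  ext d h M = ext d' h' M' -> [/\ M = M', d = d' & M (h - h')].
Proof.
move=> latM latM' eqE.
have eqM : M = M' by rewrite -(kern_ext d h M) eqE kern_ext.
have [c [pE Mc]] : ext d' h' M' (crow (p%:R ^+ d) h).
  rewrite -eqE; exists 1; rewrite hd_crow tl_crow mul1r scale1r subrr.
  by split=> //; apply: lat0.
have [c' [pE' _]] : ext d h M (crow (p%:R ^+ d') h').
  rewrite eqE; exists 1; rewrite hd_crow tl_crow mul1r scale1r subrr.
  by split=> //; apply: lat0.
rewrite hd_crow in pE; rewrite hd_crow in pE'.
have le_exp i j (z : Zp) : p%:R ^+ i = z * p%:R ^+ j -> (j <= i)%N.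
  rewrite leqNgt => zE; apply/negP => lt_ij.
  have : p%:R ^+ i * 1 = p%:R ^+ i * (p%:R ^+ (j - i) * z) :> Zp.
    by rewrite mulr1 mulrA -exprD subnKC 1?ltnW // mulrC.
  move=> /(mul_expI p_gt1) E; have := residue_expM (j - i) z.
  rewrite -E -[1]/(1%:~R) residue_int modz_small // ltz_nat.
  by rewrite /= -[1%N](expn0 p) ltn_exp2l // subn_gt0.
have dE : d = d' by apply/eqP; rewrite eqn_leq (le_exp _ _ _ pE) (le_exp _ _ _ pE').
split=> //; move: Mc; rewrite tl_crow eqM.
suff -> : c = 1 by rewrite scale1r.
by apply: (@mul_expIr d); rewrite mul1r {1}dE -pE.
Qed.

Lemma eq_ext d h h' M : sublattice M -> M (h - h') -> ext d h M = ext d h' M.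
Proof.
have sub g g' : sublattice M -> M (g - g') -> ext d g M `<=` ext d g' M.
  move=> latM Mg v [c [vE Mv]]; exists c; split=> //.
  rewrite (_ : _ - _ = (tl v - c *: g) + c *: (g - g')).
    by apply: latD => //; apply: latZ.
  by rewrite scalerBr addrA subrK.
move=> latM Mh; apply/seteqP; split; first exact: sub.
by apply: sub => //; rewrite -opprB; apply: latN.
Qed.

(** Cutting off the first row and column of a Hermite normal form exhibits the
    lattice as an extension; with [ext_inj] this gives the uniqueness of the
    diagonal. *)
Lemma hermite_cons (d : n.+1.-tuple nat) L (H : 'M[Zp]_n.+1) :
  hermite_matrix L d H ->
  exists M h H', L = ext (thead d) h M /\ hermite_matrix M (behead_tuple d) H'.
Proof.
move=> [lowH diagH LE].
pose B : 'M_(1 + n) := H.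
pose M := [set u *m drsubmx B | u in [set: 'rV[Zp]_n]].
exists M, (ursubmx B), (drsubmx B).
have dl0 : dlsubmx B = 0.
  by apply/matrixP => i j; rewrite !mxE lowH //= !ord1.
have hd_mul (u : 'rV_(1 + n)) : hd (u *m B) = hd u * p%:R ^+ thead d.
  rewrite /hd mxE (bigD1 ord0) //= diagH big1 ?addr0 // => i i0.
  by rewrite lowH ?mulr0 // lt0n.
have tl_mul (u : 'rV_(1 + n)) : tl (u *m B) = hd u *: ursubmx B + tl u *m drsubmx B.
  rewrite /tl -{1}(hsubmxK u) -{1}(submxK B) mul_row_block row_mxKr; congr (_ + _).
  rewrite -mul_scalar_mx; congr (_ *m _); apply/rowP => i.
  by rewrite !ord1 !mxE eqxx mulr1n /hd; congr (u _ _); apply/val_inj.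
split; last first.
  split=> [i j lt_ij|i|//]; first by rewrite !mxE lowH.
  rewrite !mxE diagH /= tnth_behead; congr (_ ^+ tnth _ _); apply/val_inj => /=.
  by rewrite inordK ?ltnS.
rewrite LE; apply/seteqP; split=> v.
  move=> [u _ <-]; exists (hd u); rewrite hd_mul tl_mul; split=> //.
  by rewrite addrAC subrr add0r; exists (tl u).
move=> [c [vE [u _ uE]]]; exists (crow c u) => //.
rewrite -[v]crow_hd_tl -[LHS]crow_hd_tl; congr crow.
  by rewrite hd_mul hd_crow.
by rewrite tl_mul hd_crow tl_crow uE addrC subrK.
Qed.

Lemma hermite_ext (d : n.-tuple nat) M H' e h :
  hermite_matrix M d H' ->
  exists H, hermite_matrix (ext e h M) [tuple of e :: d] H.
Proof.
move=> [lowH diagH ME].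
pose Be : 'M[Zp]_1 := (p%:R ^+ e)%:M.
pose B : 'M_(1 + n) := block_mx Be h 0 H'.
exists B; split.
- move=> i j; case: (@split_ordP 1 n i) => i' ->; case: (@split_ordP 1 n j) => j' ->;
    rewrite /B ?ord1 //; first by rewrite (block_mxEdl Be h 0 H') mxE.
  by rewrite (block_mxEdr Be h 0 H') ltn_add2l => lt_ij; apply: lowH.
- move=> i; case: (@split_ordP 1 n i) => i' ->; rewrite /B.
    by rewrite !ord1 (block_mxEul Be h 0 H') mxE eqxx.
  rewrite (block_mxEdr Be h 0 H') diagH; congr (_ ^+ _).
  by rewrite !(tnth_nth 0%N).
have mulB u : crow (hd u * p%:R ^+ e) (hd u *: h + tl u *m H') = u *m B.
  have := mul_row_block ((hd u)%:M : 'M_1) (tl u) Be h 0 H'.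
  rewrite /Be -scalar_mxM mul_scalar_mx mulmx0 addr0 => E.
  by rewrite -[in RHS](crow_hd_tl u); symmetry; exact: E.
apply/seteqP; split=> v.
  move=> [c [vE]]; rewrite ME => -[u _ uE]; exists (crow c u) => //.
  by rewrite -mulB hd_crow tl_crow uE -vE addrC subrK crow_hd_tl.
move=> [u _ <-]; rewrite -mulB; exists (hd u); rewrite hd_crow tl_crow ME.
by split=> //; rewrite addrAC subrr add0r; exists (tl u).
Qed.

End Extensions.

(** * Hermite normal form of an extension *)

Section Hermite.
Variable p : nat.
Hypothesis p_pr : prime p.
Local Notation Zp := (padic_int p).
Local Open Scope classical_set_scope.

Lemma hermite_sublattice n (L : set 'rV[Zp]_n) d H :
  hermite_matrix L d H -> sublattice L.
Proof.
move=> [_ _ ->]; apply/sublatticeP; split; first by exists 0; rewrite ?mul0mx.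
by move=> a _ _ [u _ <-] [v _ <-]; exists (a *: u + v); rewrite // mulmxDl scalemxAl.
Qed.

Lemma hermite_exists n (L : set 'rV[Zp]_n) k : level k L ->
  exists d H, hermite_matrix L d H.
Proof.
elim: n L => [|n IHn] L levL.
  exists [tuple], 0; split=> [[]//|[]//|].
  apply/seteqP; split=> v _; first by exists 0 => //; apply/rowP => -[].
  by rewrite (_ : v = 0); [apply: lat0; case: levL | apply/rowP => -[]].
have [d [H hermH]] := IHn _ (kern_level levL).
have [e [h [_ ->]]] := level_ext p_pr levL.
by have [H' ?] := hermite_ext e h hermH; exists [tuple of e :: d], H'.
Qed.

Lemma hermite_uniq n (L : set 'rV[Zp]_n) d H d' H' :
  hermite_matrix L d H -> hermite_matrix L d' H' -> d = d'.
Proof.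
elim: n L d H d' H' => [|n IHn] L d H d' H' herm herm'.
  by rewrite [d]tuple0 [d']tuple0.
have [M [h [G [LE hM]]]] := hermite_cons herm.
have [M' [h' [G' [LE' hM']]]] := hermite_cons herm'.
have [] := @ext_inj p p_pr n (thead d) h M (thead d') h' M'.
- exact: hermite_sublattice hM.
- exact: hermite_sublattice hM'.
- by rewrite -LE.
move=> eM ed _; rewrite [d]tuple_eta [d']tuple_eta ed; congr [tuple of _ :: _].
by rewrite -eM in hM'; rewrite (IHn _ _ _ _ _ hM hM').
Qed.

Lemma deltaP n (L : set 'rV[Zp]_n) k : level k L ->
  exists H, hermite_matrix L (delta L) H.
Proof.
move=> levL; have [d [H hermH]] := hermite_exists levL.
rewrite /delta; case: xgetP => [d' -> //|/(_ d)]; case.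
by exists H.
Qed.

Lemma delta_ext n (M : set 'rV[Zp]_n) k d h : level k M ->
  delta (ext d h M) = [tuple of d :: delta M].
Proof.
move=> levM; have [H hM] := deltaP levM; have [H' hE] := hermite_ext d h hM.
rewrite {1}/delta; case: xgetP => [d' _ [G hG]|/(_ [tuple of d :: delta M])].
  exact: hermite_uniq hG hE.
by case; exists H'.
Qed.

End Hermite.

(** * Presentations of quotients by cyclic groups *)

Lemma eqmod0P (d a : int) : reflect (a = 0 %[mod d])%Z (d %| a)%Z.
Proof. by rewrite -[a in (_ %| a)%Z]subr0 -eqz_mod_dvd; apply: eqP. Qed.

Section Presentations.
Variable p : nat.
Hypothesis p_pr : prime p.
Let p_gt1 : (1 < p)%N. Proof. exact: prime_gt1. Qed.
Local Open Scope classical_set_scope.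

(** An isomorphism of V / L with the direct sum of the Z/p^(nu i), written with
    integer representatives. Compared with maps into ordinals of varying size,
    this allows the exponents to be decreased without changing the map. *)
Definition presents (V : zmodType) (I : finType) (L : set V) (nu : I -> nat)
    (f : V -> I -> int) :=
  [/\ forall u v i, (f (u + v) i = f u i + f v i %[mod (p ^ nu i)%N])%Z,
      forall t : I -> int, exists v, forall i, (f v i = t i %[mod (p ^ nu i)%N])%Z
    & forall v, L v <-> forall i, ((p ^ nu i)%N %| f v i)%Z].

Section Zmod.
Variables (V : zmodType) (I : finType) (L : set V) (nu : I -> nat).
Variable f : V -> I -> int.
Hypothesis Pf : presents L nu f.

Lemma pres_add u v i : (f (u + v) i = f u i + f v i %[mod (p ^ nu i)%N])%Z.
Proof. by case: Pf. Qed.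
Lemma pres_surj (t : I -> int) :
  exists v, forall i, (f v i = t i %[mod (p ^ nu i)%N])%Z.
Proof. by case: Pf. Qed.
Lemma pres_ker v : L v <-> forall i, ((p ^ nu i)%N %| f v i)%Z.
Proof. by case: Pf. Qed.

Lemma pres0 i : (f 0 i = 0 %[mod (p ^ nu i)%N])%Z.
Proof.
have := pres_add 0 0 i; rewrite addr0 => /eqP.
by rewrite eqz_mod_dvd opprD addrA subrr add0r rpredN => /dvdz_mod0P ->; rewrite mod0z.
Qed.

Lemma pres_opp v i : (f (- v) i = - f v i %[mod (p ^ nu i)%N])%Z.
Proof.
have := pres_add v (- v) i; rewrite subrr pres0 => /esym/eqP.
rewrite eqz_mod_dvd subr0 addrC -[f v i]opprK -eqz_mod_dvd => /eqP ->.
by rewrite opprK.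
Qed.

Lemma pres_sub u v i : (f (u - v) i = f u i - f v i %[mod (p ^ nu i)%N])%Z.
Proof. by rewrite pres_add -modzDmr pres_opp modzDmr. Qed.

Lemma pres_muln v j i : (f (v *+ j) i = f v i *+ j %[mod (p ^ nu i)%N])%Z.
Proof.
elim: j => [|j IHj]; first by rewrite !mulr0n pres0.
by rewrite !mulrS pres_add -modzDmr IHj modzDmr.
Qed.

(** Multiplication by p identifies V / {v | p v in L} with p (V / L); the map f
    itself still serves. *)
Lemma pres_div : presents [set v | L (v *+ p)] (fun i => (nu i).-1) f.
Proof.
have small u v i : (u = v %[mod (p ^ nu i)%N] -> u = v %[mod (p ^ (nu i).-1)%N])%Z.
  move=> /eqP; rewrite eqz_mod_dvd => dv; apply/eqP; rewrite eqz_mod_dvd.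
  by apply: dvdz_trans dv; rewrite dvdzE /= dvdn_exp2l // leq_pred.
split=> [u v i|t|v]; first exact/small/pres_add.
  by have [v vt] := pres_surj t; exists v => i; apply: small.
have dvd_div i : ((p ^ nu i)%N %| f (v *+ p) i)%Z = ((p ^ (nu i).-1)%N %| f v i)%Z.
  have /eqP := pres_muln v p i; rewrite eqz_mod_dvd => dv.
  rewrite -[f (v *+ p) i](subrK (f v i *+ p)) (rpredDl _ dv).
  case: (nu i) => [|j] /=; first by rewrite !dvd1z.
  by rewrite expnS PoszM -mulr_natl natz dvdz_mul2l // -lt0n prime_gt0.
by rewrite /= pres_ker; split=> Lv i; have := Lv i; rewrite dvd_div.
Qed.

(** (V / L) / p is a sum of copies of Z/p, one for each nonzero exponent. *)
Lemma pres_mod_p :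
  presents [set v | exists w, L (v + w *+ p)]
    (fun i : {i | (0 < nu i)%N} => 1%N) (fun v i => f v (val i)).
Proof.
have small u v (i : {i | (0 < nu i)%N}) :
    (u = v %[mod (p ^ nu (val i))%N] -> u = v %[mod (p ^ 1)%N])%Z.
  move=> /eqP; rewrite eqz_mod_dvd => dv; apply/eqP; rewrite eqz_mod_dvd.
  by apply: dvdz_trans dv; rewrite dvdzE /= dvdn_exp2l // (valP i).
split=> [u v i|t|v]; first exact/small/pres_add.
  pose t' i := if insub i is Some j then t j else 0.
  have [v vt] := pres_surj t'; exists v => i.
  by apply: small; apply: etrans (vt (val i)) _; rewrite /t' valK.
split=> [[w /pres_ker Lw] i|pv].
  have /eqmod0P/small E := Lw (val i); apply/eqmod0P; rewrite -E.
  apply/esym; rewrite (small _ _ _ (pres_add _ _ _)) -modzDmr (small _ _ _ (pres_muln _ _ _)).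
  by rewrite modzDmr expn1 -mulr_natr natz addrC modzMDl.
have /choice[g gP] i : exists g : int, (0 < nu i)%N -> f v i = g * Posz p.
  case: (posnP (nu i)) => [_|i0]; first by exists 0.
  by have := pv (exist _ i i0); rewrite /= expn1 => /dvdzP[g ->]; exists g.
have [w wg] := pres_surj (fun i => - g i).
exists w; apply/pres_ker => i; case: (posnP (nu i)) => [->|i0].
  by rewrite expn0 dvd1z.
apply/eqmod0P; rewrite pres_add -modzDmr pres_muln -mulr_natr natz.
by rewrite -modzMml wg modzMml modzDmr mulNr gP // subrr.
Qed.

End Zmod.

(** Two presentations of the same quotient by copies of Z/p have the same
    cardinality, p to the number of copies. *)
Lemma pres_rank_leq (V : zmodType) (I J : finType) (K : set V)
    (f : V -> I -> int) (g : V -> J -> int) :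
  presents K (fun=> 1%N) f -> presents K (fun=> 1%N) g -> (#|I| <= #|J|)%N.
Proof.
move=> Pf Pg; have p_gt0 := ltnW p_gt1.
have /choice[v vP] (t : {ffun I -> 'I_p}) :
    exists v, forall i, (f v i = t i %[mod (p ^ 1)%N])%Z.
  exact: (pres_surj Pf (fun i => Posz (t i))).
have res_lt x : (absz (x %% p)%Z < p)%N.
  by rewrite -ltz_nat gez0_abs ?modz_ge0 ?ltz_pmod // -lt0n.
pose F t : {ffun J -> 'I_p} := [ffun j => Ordinal (res_lt (g (v t) j))].
suff injF : injective F.
  have := leq_card F injF; rewrite !card_ffun !card_ord leq_exp2l //.
move=> t s eqF.
have : K (v t - v s).
  apply/(pres_ker Pg) => j; apply/eqmod0P; rewrite (pres_sub Pg).
  apply/eqmod0P; rewrite -eqz_mod_dvd expn1; apply/eqP.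
  have := congr1 (fun h : {ffun J -> 'I_p} => Posz (h j)) eqF.
  by rewrite !ffunE /= !gez0_abs ?modz_ge0 -?lt0n // => ->.
move=> /(pres_ker Pf) Kts; apply/ffunP => i; apply/val_inj.
have /eqmod0P := Kts i; rewrite (pres_sub Pf) => /eqmod0P.
rewrite -eqz_mod_dvd !vP expn1 !modz_small ?ltz_nat //=.
by move=> /eqP[].
Qed.

Lemma pres_rank (V : zmodType) (I J : finType) (K : set V)
    (f : V -> I -> int) (g : V -> J -> int) :
  presents K (fun=> 1%N) f -> presents K (fun=> 1%N) g -> #|I| = #|J|.
Proof.
by move=> Pf Pg; apply/eqP; rewrite eqn_leq (pres_rank_leq Pf Pg) (pres_rank_leq Pg Pf).
Qed.

End Presentations.

(** * The first column of the type of an extension *)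

Section RankExt.
Variable p : nat.
Hypothesis p_pr : prime p.
Let p_gt1 : (1 < p)%N. Proof. exact: prime_gt1. Qed.
Local Notation Zp := (padic_int p).
Local Open Scope classical_set_scope.

Lemma scale_expn n k (w : 'rV[Zp]_n) : p%:R ^+ k *: w = w *+ p ^ k.
Proof. by rewrite -natrX scaler_nat. Qed.
Lemma scale_p n (w : 'rV[Zp]_n) : p%:R *: w = w *+ p.
Proof. by rewrite scaler_nat. Qed.

(** Additive maps to Z/p^a are automatically Z_p-linear. *)
Lemma pres_scale n (I : finType) (L : set 'rV[Zp]_n) (nu : I -> nat) f c v i k :
  presents p L nu f -> (nu i <= k)%N ->
  (f (c *: v) i = residue c k * f v i %[mod (p ^ nu i)%N])%Z.
Proof.
move=> Pf le_k; have [y cE] := padic_split p_gt1 c k.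
have -> : c *: v = v *~ residue c k + (y *: v) *+ p ^ k.
  by rewrite {1}cE scalerDl scaler_int -scalerA scale_expn.
rewrite (pres_add Pf) -modzDmr (pres_muln Pf) -mulr_natr natz.
rewrite -(subnK le_k) expnD PoszM mulrA modzMl addr0 -(subnK le_k).
case: (residue c _) => j; first by rewrite -pmulrn (pres_muln Pf) -mulr_natl natz.
rewrite NegzE mulrNz -pmulrn (pres_opp Pf) -modzNm (pres_muln Pf).
by rewrite modzNm -mulr_natl natz mulNr.
Qed.

Section Rank.
Variables (n : nat) (M : set 'rV[Zp]_n) (mu : 'I_n -> nat) (f : 'rV[Zp]_n -> 'I_n -> int).
Hypothesis Pf : presents p M mu f.
Variables (d : nat) (h : 'rV[Zp]_n).

(** Whether d > 0 and h lies in p Z_p^n + M. *)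
Definition adds_box := (0 < d)%N && [forall i, (0 < mu i)%N ==> (p %| f h i)%Z].

Let I' := {i | (0 < mu i)%N}.
Let g0 v (i : I') := f v (val i).
Let Mp := [set v | exists w, M (v + w *+ p)].
Let Pg : presents p Mp (fun _ : I' => 1%N) g0. Proof. exact: pres_mod_p. Qed.
Let K := [set v | exists w, ext d h M (v + w *+ p)].

(* Membership in L + p Z_p^(n+1) for L = ext d h M, in terms of M + p Z_p^n. *)
Let K_P v : K v <->
  exists c, residue (hd v - c * p%:R ^+ d) 1 = 0 /\ Mp (tl v - c *: h).
Proof.
have addE (u w : 'rV[Zp]_n.+1) : u + w *+ p = p%:R *: w + u.
  by rewrite scale_p addrC.
split=> [[w [c []]]|[c [hc [w Mw]]]].
  rewrite addE hd_lin tl_lin => vE Mv; exists c; split.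
    have -> : hd v - c * p%:R ^+ d = p%:R ^+ 1 * - hd w.
      by rewrite -vE opprD addrCA subrr addr0 expr1 mulrN.
    exact: residue_expM.
  by exists (tl w); rewrite -scale_p addrC addrA.
have [y yE] := padic_div p_gt1 hc; rewrite expr1 in yE.
exists (crow (- y) w), c; rewrite addE hd_lin tl_lin hd_crow tl_crow; split.
  by rewrite mulrN -yE opprB subrK.
by rewrite scale_p -addrA addrC.
Qed.

Let resD (x y : Zp) : (residue (x + y) 1 = residue x 1 + residue y 1 %[mod (p ^ 1)%N])%Z.
Proof. by rewrite residueD modz_mod. Qed.
Let tlD (u v : 'rV[Zp]_n.+1) : tl (u + v) = tl u + tl v.
Proof. by rewrite -[u]scale1r tl_lin !scale1r. Qed.
Let hdD (u v : 'rV[Zp]_n.+1) : hd (u + v) = hd u + hd v.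
Proof. by rewrite -[u]scale1r hd_lin !scale1r mul1r. Qed.
Let g0_scale c v i : (g0 (c *: v) i = residue c 1 * g0 v i %[mod (p ^ 1)%N])%Z.
Proof. exact: (pres_scale c v Pg). Qed.
Let residue0 (x : Zp) : ((p ^ 1)%N %| residue x 1)%Z -> residue x 1 = 0.
Proof. by move=> /dvdz_mod0P; rewrite residue_mod. Qed.
Let res_pd (c : Zp) : (0 < d)%N -> residue (c * p%:R ^+ d) 1 = 0.
Proof.
case: d => // e _; rewrite exprS mulrCA -[p%:R]expr1; exact: residue_expM.
Qed.
Let residueB (x y : Zp) : residue y 1 = 0 -> residue (x - y) 1 = residue x 1.
Proof. by move=> y0; rewrite residueD residueN y0 oppr0 mod0z addr0 residue_mod. Qed.

(** For d = 0 the first coordinate can be eliminated with the vector (1, h). *)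
Lemma rank_ext0 : d = 0%N ->
  exists g, presents p K (fun _ : I' => 1%N) g.
Proof.
move=> d0; exists (fun v => g0 (tl v - hd v *: h)); split=> [u v i|t|v].
- by rewrite hdD tlD scalerDl opprD addrACA (pres_add Pg).
- have [v vt] := pres_surj Pg t; exists (crow 0 v) => i.
  by rewrite hd_crow tl_crow scale0r subr0 vt.
rewrite K_P; split=> [[c [hc Mc]]|Kv]; last first.
  exists (hd v); rewrite d0 mulr1 subrr; split; last exact/(pres_ker Pg).
  by rewrite -[0]/(0%:~R) residue_int mod0z.
move: hc; rewrite d0 mulr1 => hc.
move=> i; apply/eqmod0P.
have -> : tl v - hd v *: h = (tl v - c *: h) - (hd v - c) *: h.
  by rewrite scalerBl opprB addrA subrK.
rewrite (pres_sub Pg) -modzDmr -modzNm g0_scale hc mul0r modzNm oppr0 modzDmr addr0.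
by apply/eqmod0P; exact: (proj1 (pres_ker Pg _) Mc).
Qed.

(** The vector (p^d, h) is congruent modulo p to an element of M, so the first
    coordinate is a new generator of the quotient modulo p. *)
Lemma rank_ext_box : adds_box ->
  exists g, presents p K (fun _ : option I' => 1%N) g.
Proof.
move=> /andP[d0 /forallP ph].
exists (fun v o => if o is Some i then g0 (tl v) i else residue (hd v) 1).
split=> [u v [i|]|t|v].
- by rewrite tlD (pres_add Pg).
- by rewrite hdD resD.
- have [v vt] := pres_surj Pg (fun i => t (Some i)).
  exists (crow (t None)%:~R v) => -[i|]; first by rewrite tl_crow vt.
  by rewrite hd_crow residue_int modz_mod.
have g0h c i : (g0 (c *: h) i = 0 %[mod (p ^ 1)%N])%Z.
  rewrite g0_scale; apply/eqmod0P; rewrite dvdz_mull // expn1.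
  by have := ph (val i); rewrite (valP i).
rewrite K_P; split=> [[c [hc Mc]]|Kv].
  case=> [i|]; last by rewrite -(residueB _ (res_pd c d0)) hc dvdz0.
  apply/eqmod0P; rewrite -[tl v](subrK (c *: h)) (pres_add Pg) -modzDmr g0h modzDmr addr0.
  by apply/eqmod0P; exact: (proj1 (pres_ker Pg _) Mc).
exists 0; rewrite mul0r scale0r !subr0; split; first exact: (residue0 (Kv None)).
by apply/(pres_ker Pg) => i; apply: (Kv (Some i)).
Qed.

(** The first coordinate is a new generator, but the class of h is killed: a
    coordinate i0 where h is a unit modulo p is used to eliminate it. *)
Lemma rank_ext_nobox : (0 < d)%N -> ~~ adds_box ->
  exists (J : finType) g, #|J| = #|{: I'}| /\ presents p K (fun _ : J => 1%N) g.
Proof.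
move=> d0; rewrite /adds_box d0 /= negb_forall => /existsP[i1]; rewrite negb_imply => /andP[mu1 np].
pose i0 : I' := exist _ i1 mu1.
have np0 : ~~ (p %| g0 h i0)%Z by [].
(* u is the inverse of the i0-th coordinate of h modulo p. *)
have [u [w uw]] : exists u w, u * g0 h i0 + w * Posz p = 1.
  have [u [w uw]] := Bezoutz (g0 h i0) p; exists u, w; rewrite uw.
  have : coprime `|g0 h i0|%N p by rewrite coprime_sym prime_coprime.
  by rewrite /coprime /gcdz => /eqP->.
pose J := option {i : I' | i != i0}.
exists J, (fun v o => if o is Some i
  then g0 (tl v) (val i) * g0 h i0 - g0 (tl v) i0 * g0 h (val i)
  else residue (hd v) 1); split.
  rewrite card_option card_sig cardC1 prednK //.
  by apply/card_gt0P; exists i0.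
have dvd_p (x y : int) : (x = y %[mod (p ^ 1)%N])%Z <-> (p %| x - y)%Z.
  by rewrite -eqz_mod_dvd expn1; split=> /eqP.
have dvdM (x y : int) : (p %| x)%Z -> (p %| y * x)%Z by move=> px; rewrite dvdz_mull.
split=> [x y [i|]|t|v].
- rewrite tlD; apply/dvd_p.
  have /dvd_p e1 := pres_add Pg (tl x) (tl y) (val i).
  have /dvd_p e2 := pres_add Pg (tl x) (tl y) i0.
  move: e1 e2; set a := g0 h i0; set b := g0 h _; set xy := g0 _ (val i); set xy0 := g0 _ i0.
  move=> /(dvdM _ a) e1 /(dvdM _ b) e2.
  by have := rpredB e1 e2; congr (_ %| _)%Z; ring.
- by rewrite hdD resD.
- pose t' i := if insub i : option {i : I' | i != i0} is Some j then u * t (Some j) else 0.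
  have [x xt] := pres_surj Pg t'; exists (crow (t None)%:~R x) => -[i|]; last first.
    by rewrite hd_crow residue_int modz_mod.
  rewrite tl_crow; apply/dvd_p.
  have /dvd_p := xt (val i); rewrite /t' valK => /(dvdM _ (g0 h i0)) e1.
  have /dvd_p := xt i0; rewrite /t' insubN ?eqxx // subr0 => /(dvdM _ (g0 h (val i))) e2.
  have e3 : (p %| t (Some i) * w * p)%Z by rewrite dvdz_mull.
  have := rpredB (rpredB e1 e2) e3; congr (_ %| _)%Z.
  rewrite -mulrA; have -> : w * p = 1 - u * g0 h i0 by rewrite -uw addrC addKr.
  by ring.
rewrite K_P; split=> [[c [hc Mc]]|Kv].
  case=> [i|]; last by rewrite -(residueB _ (res_pd c d0)) hc dvdz0.
  rewrite expn1.
  have E j : (p %| g0 (tl v) j - residue c 1 * g0 h j)%Z.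
    have := proj1 (pres_ker Pg _) Mc j => /eqmod0P; rewrite (pres_sub Pg) -modzDmr -modzNm.
    by rewrite g0_scale modzNm modzDmr => /eqmod0P; rewrite expn1.
  have := rpredB (dvdM _ (g0 h i0) (E (val i))) (dvdM _ (g0 h (val i)) (E i0)).
  by congr (_ %| _)%Z; ring.
exists (g0 (tl v) i0 * u)%:~R; split.
  by rewrite residueB ?res_pd //; apply: residue0; apply: (Kv None).
apply/(pres_ker Pg) => i; apply/eqmod0P; rewrite (pres_sub Pg) -modzDmr -modzNm g0_scale.
rewrite residue_int modzMml modzNm modzDmr; apply/eqmod0P; rewrite expn1.
have wpE : w * p = 1 - u * g0 h i0 by rewrite -uw addrC addKr.
have e3 : (p %| g0 (tl v) i * (w * p))%Z by rewrite mulrA dvdz_mull.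
have [->|ni] := eqVneq i i0.
  have e4 : (p %| g0 (tl v) i0 * (w * p))%Z by rewrite mulrA dvdz_mull.
  by move: e4; congr (_ %| _)%Z; rewrite wpE; ring.
have := Kv (Some (exist _ i ni)); rewrite /= expn1 => /(dvdM _ u) e4.
by have := rpredD e4 e3; congr (_ %| _)%Z; rewrite wpE; ring.
Qed.

(** The height of the first column of the type of an extension. *)
Lemma rank_ext (nu : 'I_n.+1 -> nat) fL : presents p (ext d h M) nu fL ->
  #|{: {i | (0 < nu i)%N}}| = (adds_box + #|{: I'}|)%N.
Proof.
move=> /pres_mod_p PL.
case: (boolP adds_box) => [bx|nbx].
  have [g Pg'] := rank_ext_box bx.
  by rewrite (pres_rank p_pr PL Pg') card_option.
case: (posnP d) => [d0|dpos].
  by have [g Pg'] := rank_ext0 d0; rewrite (pres_rank p_pr PL Pg').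
by have [J [g [<- Pg']]] := rank_ext_nobox dpos nbx; rewrite (pres_rank p_pr PL Pg').
Qed.

End Rank.
End RankExt.

(** * The type of an extension *)

Section WeightExt.
Variable p : nat.
Hypothesis p_pr : prime p.
Let p_gt1 : (1 < p)%N. Proof. exact: prime_gt1. Qed.
Let p_gt0 : (0 < p)%N. Proof. exact: prime_gt0. Qed.
Local Notation Zp := (padic_int p).
Local Open Scope classical_set_scope.

(** The number of columns of the type is the exponent of the quotient. *)
Lemma pres_exponent (V : zmodType) (I : finType) (L : set V) (nu : I -> nat) f k :
  presents p L nu f -> (forall v, L (v *+ p ^ k)) <-> forall i, (nu i <= k)%N.
Proof.
move=> Pf; split=> [Lk i|nu_k v].
  have [v vt] := pres_surj Pf (fun=> 1).
  have /(pres_ker Pf)/(_ i)/eqmod0P := Lk v.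
  rewrite (pres_muln Pf) -mulr_natr natz -modzMml vt modzMml mul1r => /eqmod0P.
  by rewrite dvdzE /= dvdn_Pexp2l.
apply/(pres_ker Pf) => i; apply/eqmod0P.
rewrite (pres_muln Pf) -mulr_natr natz -(subnK (nu_k i)) expnD PoszM mulrA.
by rewrite modzMl mod0z.
Qed.

Lemma div_sublattice n (M : set 'rV[Zp]_n) : sublattice M ->
  sublattice [set v | M (v *+ p)].
Proof.
move=> latM; apply/sublatticeP; split; first by rewrite /= mul0rn; apply: lat0.
move=> a u v Mu Mv; rewrite /= mulrnDl scalerMnr.
by apply: latD => //; apply: latZ.
Qed.

Section Div.
Variables (n : nat) (M : set 'rV[Zp]_n) (mu : 'I_n -> nat) (f : 'rV[Zp]_n -> 'I_n -> int).
Hypotheses (latM : sublattice M) (Pf : presents p M mu f).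
Variables (d : nat) (h : 'rV[Zp]_n).

Let hdMp (v : 'rV[Zp]_n.+1) : hd (v *+ p) = p%:R * hd v.
Proof. by rewrite -scale_p hdZ. Qed.
Let tlMp (v : 'rV[Zp]_n.+1) : tl (v *+ p) = tl v *+ p.
Proof. by rewrite -scale_p tlZ scale_p. Qed.
Let p_inj : injective (fun x : Zp => p%:R * x).
Proof. by have := @mul_expI p p_gt1 1; rewrite expr1. Qed.

(** If p v = c (p^d, h) modulo M then c is divisible by p: for d = 0 it is p
    times the first coordinate of v, and for d > 0 an invertible c would put h
    into p Z_p^n + M. *)
Lemma div_ext_nobox : ~~ @adds_box p n mu f d h ->
  [set v | ext d h M (v *+ p)] = ext d h [set v | M (v *+ p)].
Proof.
move=> nbx; apply/seteqP; split=> v [c []]; rewrite /= ?hdMp ?tlMp => vE Mv; last first.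
  exists (p%:R * c); rewrite hdMp tlMp vE mulrA; split=> //.
  by rewrite -scalerA scale_p -mulrnBl.
suff [c' cE] : exists c', c = p%:R * c'.
  exists c'; rewrite cE -mulrA in vE; split; first exact: p_inj.
  by move: Mv; rewrite /= cE mulr_natl -scalerMnl -mulrnBl.
suff c0 : residue c 1 = 0 by have [c'] := padic_div p_gt1 c0; exists c'; rewrite -[p%:R]expr1.
case: (posnP d) => [d0|d0].
  by move: vE; rewrite d0 mulr1 => <-; rewrite -[p%:R]expr1; apply: residue_expM.
apply: contrapT => /eqP c0; move/negP: nbx; apply; rewrite /adds_box d0 /=.
apply/forallP => i; apply/implyP => mu0.
have /(pres_ker Pf)/(_ i) := Mv.
have dvd_p : (Posz p %| Posz (p ^ mu i))%Z by rewrite dvdzE /= dvdn_exp.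
move=> /eqmod0P; rewrite (pres_sub Pf) -modzDm (pres_muln Pf) -modzNm.
rewrite (pres_scale p_pr c h Pf (leqnn _)) modzNm modzDm => /eqmod0P /(dvdz_trans dvd_p).
rewrite -mulr_natl natz (rpredBl _ (dvdz_mulr _ (dvdzz _))).
move=> pcf; have : (p %| `|residue c (mu i)| * `|f h i|)%N by rewrite -abszM; exact: pcf.
rewrite Euclid_dvdM // => /orP[] // pc.
case/eqP: c0.
have := residue_congr c mu0; rewrite expn1 residue_mod => <-.
exact/dvdz_mod0P.
Qed.

(** Modulo M the generator (p^d, h) is p times (p^(d-1), h'). *)
Lemma div_ext_box : @adds_box p n mu f d h ->
  exists h', [/\ M (h' *+ p - h),
    [set v | ext d h M (v *+ p)] = ext d.-1 h' [set v | M (v *+ p)]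
    & forall i, (Posz p * f h' i = f h i %[mod (p ^ mu i)%N])%Z].
Proof.
case/andP=> d0 /forallP ph.
have /choice[g gP] i : exists g : int, (f h i = Posz p * g %[mod (p ^ mu i)%N])%Z.
  case: (posnP (mu i)) => [->|mu0]; first by exists 0; rewrite expn0 !modz1.
  have := ph i; rewrite mu0 => /dvdzP[g ->]; exists g; by rewrite mulrC.
have [h' hg] := pres_surj Pf g; exists h'.
have fh i : (Posz p * f h' i = f h i %[mod (p ^ mu i)%N])%Z.
  by rewrite gP -modzMmr hg modzMmr.
have Mh : M (h' *+ p - h).
  apply/(pres_ker Pf) => i; apply/eqmod0P.
  rewrite (pres_sub Pf) -modzDml (pres_muln Pf) modzDml -mulr_natl natz.
  by rewrite -modzDml fh modzDml subrr.
split=> //; apply/seteqP; split=> v [c []]; rewrite /= ?hdMp ?tlMp => vE Mv.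
  exists c; split.
    by apply: p_inj; rewrite vE mulrCA -exprS prednK.
  rewrite /= (_ : _ *+ p = (tl v *+ p - c *: h) - c *: (h' *+ p - h)).
    by apply: latB => //; apply: latZ.
  by rewrite scalerBr opprB addrA subrK mulrnBl scalerMnr.
exists c; rewrite hdMp tlMp vE mulrCA -exprS prednK //; split=> //.
rewrite (_ : _ - _ = (tl v - c *: h') *+ p + c *: (h' *+ p - h)).
  by apply: latD => //; apply: latZ.
by rewrite scalerBr addrA mulrnBl scalerMnr subrK.
Qed.

End Div.

Definition resn (a : nat) (x : int) : nat := `|(x %% (p ^ a)%N)%Z|%N.

Lemma resnE a x : Posz (resn a x) = (x %% (p ^ a)%N)%Z.
Proof. by rewrite /resn gez0_abs // modz_ge0 // -lt0n expn_gt0 p_gt0. Qed.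

Lemma eq_resn a x y : (x = y %[mod (p ^ a)%N])%Z -> resn a x = resn a y.
Proof. by rewrite /resn => ->. Qed.

Lemma resn_lt a x : (resn a x < p ^ a)%N.
Proof. by rewrite -ltz_nat resnE ltz_pmod // ltz_nat expn_gt0 p_gt0. Qed.

Lemma resn_mod a x : (resn a x %% p ^ a.-1)%N = resn a.-1 x.
Proof.
apply/eqP; rewrite -eqz_nat -modz_nat !resnE; apply/eqP.
have dv : (Posz (p ^ a.-1) %| Posz (p ^ a))%Z by rewrite dvdzE /= dvdn_exp2l // leq_pred.
rewrite {2}(divz_eq x (p ^ a)%N); have /dvdzP[q ->] := dv.
by rewrite mulrA modzMDl.
Qed.

Lemma resn_div a x y : (Posz p * y = x %[mod (p ^ a)%N])%Z ->
  (resn a x %/ p)%N = resn a.-1 y.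
Proof.
move=> /eq_resn <-; case: a => [|a] /=.
  by rewrite /resn !modz1 div0n.
apply/eqP; rewrite -eqz_nat -divz_nat !resnE expnS PoszM.
by rewrite -mulz_modr ?ltz_nat // mulKz // -lt0n.
Qed.

Definition parts n (nu : 'I_n -> nat) := [seq nu i | i <- enum 'I_n].
Definition residual n (mu : 'I_n -> nat) (x : 'I_n -> int) :=
  [seq resn (mu i) (x i) | i <- enum 'I_n].

Lemma drop_col_parts n (nu : 'I_n -> nat) :
  drop_col (parts nu) = parts (fun i => (nu i).-1).
Proof. by rewrite /drop_col /parts -map_comp. Qed.

Lemma rk_parts n (nu : 'I_n -> nat) : rk (parts nu) = #|{: {i | (0 < nu i)%N}}|.
Proof.
rewrite /rk count_map -sum1_count big_enum_cond sum1_card card_sig.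
by apply: eq_card => i.
Qed.

Lemma all_parts n (nu : 'I_n -> nat) a : all a (parts nu) <-> forall i, a (nu i).
Proof.
split=> [/allP nuP i|nuP]; first by apply: nuP; apply/map_f; rewrite mem_enum.
by apply/allP => _ /mapP[i _ ->].
Qed.

Lemma residual_redm n (mu : 'I_n -> nat) x :
  redm p (parts mu) (residual mu x) = residual (fun i => (mu i).-1) x.
Proof.
rewrite /parts /residual; elim: (enum 'I_n) => //= i s ->.
by rewrite resn_mod.
Qed.

Lemma residual_divm n (mu : 'I_n -> nat) x y :
  (forall i, (Posz p * y i = x i %[mod (p ^ mu i)%N])%Z) ->
  divm p (residual mu x) = residual (fun i => (mu i).-1) y.
Proof.
move=> xy; rewrite /divm /residual -map_comp; apply: eq_map => i /=.
exact: resn_div.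
Qed.

Lemma dvd_resn a x : (p %| resn a x)%N = ((0 < a)%N ==> (p %| x)%Z).
Proof.
rewrite -[(p %| _)%N]/(Posz p %| Posz (resn a x))%Z resnE.
case: a => [|a] /=; first by rewrite expn0 modz1 dvdz0.
have e : (Posz p %| (x %/ (p ^ a.+1)%N)%Z * (p ^ a.+1)%N)%Z.
  by rewrite dvdz_mull // dvdzE /= dvdn_exp.
by rewrite [in RHS](divz_eq x (p ^ a.+1)%N) (rpredDl _ e).
Qed.

Lemma residual_box n (mu : 'I_n -> nat) (f : 'rV[Zp]_n -> 'I_n -> int) d h :
  (0 < d)%N && pdiv_all p (residual mu (f h)) = @adds_box p n mu f d h.
Proof.
congr (_ && _); rewrite /pdiv_all /residual all_map; apply/allP/forallP => ph i.
  by have /= := ph i; rewrite mem_enum dvd_resn; apply.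
by move=> _; rewrite /= dvd_resn; apply: ph.
Qed.

(** Both sides remove one column at a time. For k = 0 both ask whether the
    lattice is everything. *)
Lemma ext_weightE (R : comNzRingType) (X : nat -> R) n k M (mu : 'I_n -> nat)
    (f : 'rV[Zp]_n -> 'I_n -> int) d h (nu : 'I_n.+1 -> nat) fL :
  sublattice M -> presents p M mu f -> presents p (ext d h M) nu fL ->
  ext_weight p X k (parts mu) (residual mu (f h)) d
  = if [forall i, nu i <= k]%N then type_weight X k (parts nu) else 0.
Proof.
elim: k M mu d h nu => [|k IHk] M mu d h nu latM Pf PL /=.
  rewrite /type_weight big_nil; have := pres_exponent 0 Pf; have := pres_exponent 0 PL.
  rewrite expn0 => extT MT; set b := [forall _, _].
  suff -> : (d == 0%N) && all (pred1 0%N) (parts mu) = b by case: b.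
  apply/andP/forallP => [[/eqP d0 /all_parts mu0] i|nu0].
    apply: (proj1 extT) => v; exists (hd v); rewrite d0 mulr1; split=> //.
    by apply: (proj2 MT) => j; rewrite (eqP (mu0 j)).
  have LT v : ext d h M v by exact: (proj2 extT nu0 v).
  have d0 : d = 0%N.
    have [c [E _]] := LT (crow 1 0); apply/eqP; rewrite -leqn0 leqNgt; apply/negP.
    case: d E {PL extT LT} => // d; rewrite hd_crow => E _.
    have := residue_expM 1 (p%:R ^+ d * c : Zp).
    rewrite expr1 mulrA -exprS mulrC -E -[1]/(1%:~R) residue_int expn1 modz_small //.
  split; first by rewrite d0.
  apply/all_parts => i /=; rewrite -leqn0; apply: (proj1 MT) => v.
  by rewrite -(kern_ext p_pr d h M); apply: LT.
have PdL := pres_div p_pr PL; have PdM := pres_div p_pr Pf.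
have latdM := div_sublattice latM.
rewrite residual_box residual_redm /type_weight col_heightsS big_cons.
have -> : rk (parts nu) = (@adds_box p n mu f d h + rk (parts mu))%N.
  by rewrite !rk_parts (rank_ext p_pr Pf PL).
rewrite !drop_col_parts.
have -> : [forall i, (nu i <= k.+1)%N] = [forall i, ((nu i).-1 <= k)%N].
  by apply: eq_forallb => i; case: (nu i).
case: (boolP (adds_box _ _ _ _)) => [bx|nbx]; last first.
  rewrite (div_ext_nobox Pf nbx) in PdL.
  by rewrite (IHk _ _ _ _ _ latdM PdM PdL); case: ifP; rewrite ?mulr0.
have [h' [Mh divE fh]] := div_ext_box latM Pf bx; rewrite divE in PdL.
rewrite (residual_divm fh) (IHk _ _ _ _ _ latdM PdM PdL).
by case: ifP; rewrite ?mulr0.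
Qed.

End WeightExt.

(** * Existence of types *)

Section Existence.
Variable p : nat.
Hypothesis p_pr : prime p.
Let p_gt1 : (1 < p)%N. Proof. exact: prime_gt1. Qed.
Let p_gt0 : (0 < p)%N. Proof. exact: prime_gt0. Qed.
Local Notation Zp := (padic_int p).
Local Open Scope classical_set_scope.

Lemma resv_int n k (t : 'rV[int]_n) :
  exists w : 'rV[int]_n, resv k (intv p t) = t + (Posz (p ^ k)) *: w.
Proof.
exists (\row_(i < n) - (t ord0 i %/ (p ^ k)%N)%Z); apply/rowP => i; rewrite !mxE residue_int.
by rewrite {2}(divz_eq (t 0 i) (p ^ k)%N) mulrN mulrC addrAC subrr add0r.
Qed.

Lemma resv_add n k (u v : 'rV[Zp]_n) :
  exists w : 'rV[int]_n, resv k (u + v) = resv k u + resv k v + (Posz (p ^ k)) *: w.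
Proof.
exists (\row_(i < n) - ((residue (u ord0 i) k + residue (v ord0 i) k) %/ (p ^ k)%N)%Z).
apply/rowP => i; rewrite !mxE residueD.
by rewrite {2}(divz_eq (residue (u 0 i) k + _) (p ^ k)%N) mulrN mulrC addrAC subrr add0r.
Qed.

Lemma intvD n (s t : 'rV[int]_n) : intv p (s + t) = intv p s + intv p t.
Proof. by apply/rowP => i; rewrite !mxE rmorphD. Qed.
Lemma intvZ n a (t : 'rV[int]_n) : intv p (a *: t) = a%:~R *: intv p t.
Proof. by apply/rowP => i; rewrite !mxE rmorphM. Qed.

(** The generators are the integer points of L with coordinates below p^k,
    together with p^k times the basis vectors. *)
Lemma int_generators n (L : set 'rV[Zp]_n) k : level k L ->
  exists m (M : 'M[int]_(m + n, n)), forall t : 'rV[int]_n,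
    L (intv p t) <-> exists x : 'rV_(m + n), t = x *m M.
Proof.
move=> [latL Lk]; pose q := (p ^ k)%N.
have q_gt0 : (0 < q)%N by rewrite expn_gt0 p_gt0.
pose emb (t : 'rV['I_q.-1.+1]_n) : 'rV[int]_n := \row_(i < n) Posz (t ord0 i).
pose s := [seq emb t | t <- enum {: 'rV['I_q.-1.+1]_n} & `[< L (intv p (emb t)) >]].
pose V : 'M[int]_(size s, n) := \matrix_(i, j) (nth 0 s i) 0 j.
have rowV i : row i V = nth 0 s i by apply/rowP => j; rewrite !mxE.
have Ls i : (i < size s)%N -> L (intv p (nth 0 s i)).
  move=> lt_i; have /mapP[t] := mem_nth 0 lt_i.
  by rewrite mem_filter => /andP[/asboolP Lt _] ->.
have Lq t : L (intv p ((q : int) *: t)).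
  by rewrite intvZ -[_%:~R]/(q%:R) natrX; apply: Lk.
exists (size s), (col_mx V (q : int)%:M) => t; split=> [Lt|[x ->]].
  have res_lt (i : 'I_n) : (`|(t ord0 i %% q)%Z|%N < q.-1.+1)%N.
    by rewrite prednK // -ltz_nat gez0_abs ?modz_ge0 ?ltz_pmod // -lt0n.
  pose r : 'rV['I_q.-1.+1]_n := \row_i Ordinal (res_lt i).
  pose w : 'rV[int]_n := \row_(i < n) (t ord0 i %/ q)%Z.
  have tE : t = emb r + (q : int) *: w.
    apply/rowP => i; rewrite !mxE /= gez0_abs ?modz_ge0 -?lt0n //.
    by rewrite {1}(divz_eq (t 0 i) q) mulrC addrC.
  have Lr : L (intv p (emb r)).
    by rewrite -[emb r](addrK ((q : int) *: w)) -tE -scalerN intvD; apply: latD.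
  have r_s : emb r \in s.
    by apply/mapP; exists r; rewrite // mem_filter mem_enum andbT; apply/asboolP.
  have lt_r : (index (emb r) s < size s)%N by rewrite index_mem.
  exists (row_mx (delta_mx 0 (Ordinal lt_r)) w).
  by rewrite mul_row_col -rowE rowV /= nth_index // mul_mx_scalar.
rewrite -[x]hsubmxK mul_row_col mul_mx_scalar intvD; apply: latD => //.
rewrite mulmx_sum_row.
elim/big_ind: _ => [|u v Lu Lv|i _].
- have -> : intv p (0 : 'rV_n) = 0 by apply/rowP => i; rewrite !mxE.
  exact: lat0.
- by rewrite intvD; apply: latD.
by rewrite intvZ rowV; apply: latZ => //; apply: Ls.
Qed.

(** The Smith normal form A D R of a generating matrix of the integer points of
    L presents the quotient by the coordinates of v R^-1. The diagonal entries
    of D divide p^k, because p^k times the basis vectors are in L. *)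
Lemma smith_pres n (L : set 'rV[Zp]_n) k : level k L ->
  exists nu : n.-tuple nat, sorted leq nu /\ exists f, presents p L (tnth nu) f.
Proof.
move=> levL; have [m [M MP]] := int_generators levL.
have [A uA [R uR [d sd ME]]] := int_Smith_normal_form M.
set D := (\matrix_(_, _) _) in ME.
pose q := (p ^ k)%N.
have mulD (x : 'rV_(m + n)) (j : 'I_n) :
    (x *m D) 0 j = x 0 (cast_ord (addnC n m) (lshift m j)) * d`_j.
  rewrite !mxE (bigD1 (cast_ord (addnC n m) (lshift m j))) //= mxE /= eqxx mulr1n.
  rewrite big1 ?addr0 // => i ne_ij; rewrite mxE (_ : _ == _ = false) ?mulr0 //.
  by apply: contraNF ne_ij => /eqP ij; apply/eqP/val_inj.
have spanP (t : 'rV[int]_n) :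
    L (intv p t) <-> forall j : 'I_n, (d`_j %| ((t *m invmx R) 0%R j))%Z.
  rewrite MP; split=> [[x ->] j|dt].
    by rewrite ME !mulmxA mulmxK // mulD dvdz_mull.
  have /choice[y yP] j := dvdzP (dt j).
  exists ((\row_(i < m + n) oapp y (0 : int) (insub (val i))) *m invmx A).
  rewrite ME !mulmxA mulmxKV // -[LHS](mulmxKV uR); congr (_ *m R).
  apply/rowP => j; rewrite mulD mxE yP; congr (_ * _).
  by rewrite (_ : insub _ = Some j) //; exact: valK.
have Lq t : L (intv p ((q : int) *: t)).
  by rewrite intvZ -[_%:~R]/(q%:R) natrX; case: levL.
have d_q (j : 'I_n) : (d`_j %| Posz q)%Z.
  have /spanP/(_ j) := Lq (delta_mx 0 j *m R).
  by rewrite -scalemxAl mulmxK // !mxE !eqxx mulr1.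
have /choice[e eP] (j : 'I_n) : exists e, (e <= k)%N /\ absz (d`_j) = (p ^ e)%N.
  have : (absz (d`_j)%R %| p ^ k)%N by exact: d_q j.
  by case/(dvdn_pfactor _ _ p_pr) => e le_e eE; exists e.
have dvd_d (j : 'I_n) x : (d`_j %| x)%Z = ((p ^ e j)%N %| x)%Z.
  by rewrite !dvdzE (eP j).2.
have dvd_q (j : 'I_n) : (Posz (p ^ e j) %| Posz q)%Z by rewrite -dvd_d.
exists [tuple e j | j < n]; split.
  apply/(sortedP 0%N) => i; rewrite size_tuple => lt_i.
  have lt_i' := ltnW lt_i.
  rewrite -[i]/(val (Ordinal lt_i')) -(tnth_nth 0%N [tuple e j | j < n]).
  rewrite -[_.+1]/(val (Ordinal lt_i)) -(tnth_nth 0%N [tuple e j | j < n]) !tnth_mktuple.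
  rewrite -(dvdn_Pexp2l _ _ p_gt1) -(eP _).2 -(eP _).2 /=.
  have lt_d : (i.+1 < size d)%N.
    rewrite ltnNge; apply/negP => le_d; have := d_q (Ordinal lt_i).
    by rewrite /= nth_default // dvd0z eqz_nat expn_eq0 (gtn_eqF p_gt0).
  by have /(sortedP 0) /(_ i lt_d) := sd.
pose f (v : 'rV[Zp]_n) (j : 'I_n) : int := (resv k v *m invmx R) ord0 j.
have modq (t w : 'rV[int]_n) (j : 'I_n) :
    (((t + (q : int) *: w) *m invmx R) ord0 j = (t *m invmx R) ord0 j %[mod (p ^ e j)%N])%Z.
  apply/eqP; rewrite eqz_mod_dvd mulmxDl -scalemxAl !mxE addrAC subrr add0r.
  by rewrite dvdz_mulr.
exists f; split=> [u v j|t|v].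
- rewrite tnth_mktuple /f; have [w ->] := resv_add k u v.
  by rewrite modq mulmxDl mxE.
- exists (intv p (\row_j t j *m R)) => j; rewrite tnth_mktuple /f.
  by have [w ->] := resv_int k (\row_j t j *m R); rewrite modq mulmxK // mxE.
rewrite (level_resv p_gt1 v levL) spanP; split=> dv j; have := dv j;
  by rewrite tnth_mktuple dvd_d.
Qed.

Lemma ord_addE q (a b : 'I_q.-1.+1) : (0 < q)%N -> val (a + b) = ((val a + val b) %% q)%N.
Proof. by case: q a b. Qed.

Lemma quotient_typeP n (L : set 'rV[Zp]_n) (nu : n.-tuple nat) :
  quotient_type L nu <-> exists f, presents p L (tnth nu) f.
Proof.
have pnu i : (p ^ tnth nu i).-1.+1 = (p ^ tnth nu i)%N.
  by rewrite prednK // expn_gt0 p_gt0.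
split=> [[phi [surj ker]]|[f Pf]].
  exists (fun v i => Posz (val (phi i v))); split=> [u v i|t|v].
  - by rewrite raddfD ord_addE ?expn_gt0 ?p_gt0 // -modz_nat modz_mod.
  - have lt_t i : (`|(t i %% (p ^ tnth nu i)%N)%Z|%N < (p ^ tnth nu i).-1.+1)%N.
      by rewrite pnu -ltz_nat -/(resn p _ _) (resnE p_pr) ltz_pmod // ltz_nat expn_gt0 p_gt0.
    have [v vt] := surj (fun i => Ordinal (lt_t i)).
    by exists v => i; rewrite vt /= -/(resn p _ _) (resnE p_pr) modz_mod.
  rewrite ker; split=> phi0 i; first by rewrite phi0.
  apply/val_inj; have := phi0 i; rewrite dvdzE /=.
  have lt_phi : (phi i v < p ^ tnth nu i)%N by rewrite -[X in (_ < X)%N]pnu ltn_ord.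
  by rewrite /dvdn modn_small // => /eqP.
pose g i v : 'I_(p ^ tnth nu i).-1.+1 := inZp (resn p (tnth nu i) (f v i)).
have gE i v : Posz (g i v) = (f v i %% (p ^ tnth nu i)%N)%Z.
  by rewrite /g /= pnu modn_small ?resn_lt // resnE.
have gD i : {morph g i : u v / u + v}.
  move=> u v; apply/val_inj/eqP; rewrite -eqz_nat gE (pres_add Pf).
  by rewrite ord_addE ?expn_gt0 ?p_gt0 // -modz_nat PoszD !gE modzDm.
have g0 i : g i 0 = 0 by apply: (addIr (g i 0)); rewrite -gD !add0r.
pose phi i : {additive 'rV[Zp]_n -> 'I_(p ^ tnth nu i).-1.+1} :=
  HB.pack (g i) (Algebra.isNmodMorphism.Build _ _ (g i) (g0 i, gD i)).
exists phi; split=> [t|v].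
  have [v vt] := pres_surj Pf (fun i => Posz (t i)); exists v => i.
  apply/val_inj/eqP; rewrite -eqz_nat gE vt modz_small //=.
  by rewrite ltz_nat -[X in (_ < X)%N]pnu ltn_ord.
rewrite (pres_ker Pf); split=> dv i.
  apply/val_inj/eqP; rewrite -eqz_nat gE /=; apply/eqP/dvdz_mod0P; exact: dv.
by apply/dvdz_mod0P; rewrite -gE -[g i v]/(phi i v) dv.
Qed.

Lemma nuP n (L : set 'rV[Zp]_n) k : level k L ->
  sorted leq (nu L) /\ exists f, presents p L (tnth (nu L)) f.
Proof.
move=> levL; have [s [ss /quotient_typeP Qs]] := smith_pres levL.
rewrite /nu; case: xgetP => [s' -> [ss' /quotient_typeP]|/(_ s)]; first by [].
by case.
Qed.

End Existence.

(** * Enumeration of lattices and the recursion *)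

Section Enumeration.
Variable p : nat.
Hypothesis p_pr : prime p.
Let p_gt1 : (1 < p)%N. Proof. exact: prime_gt1. Qed.
Let p_gt0 : (0 < p)%N. Proof. exact: prime_gt0. Qed.
Local Notation Zp := (padic_int p).
Local Open Scope classical_set_scope.

Lemma uniq_residues mu : uniq (residues p mu).
Proof.
elim: mu => //= a mu IHmu; apply: allpairs_uniq; rewrite ?iota_uniq //.
by move=> [x m] [x' m'] _ _ /= [-> ->].
Qed.

Lemma residual_residues n (mu : 'I_n -> nat) x :
  residual p mu x \in residues p (parts mu).
Proof.
rewrite /residual /parts; elim: (enum 'I_n) => [|i s IHs]; first by rewrite inE.
apply/allpairsPdep; exists (resn p (mu i) (x i)), [seq resn p (mu j) (x j) | j <- s].
by split=> //; rewrite mem_iota add0n resn_lt.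
Qed.

Lemma mem_residues mu m : m \in residues p mu ->
  size m = size mu /\ forall i, (nth 0%N m i < p ^ nth 0%N mu i)%N.
Proof.
elim: mu m => [|a mu IHmu] m /=; first by rewrite inE => /eqP->; split=> // -[|i].
move=> /allpairsPdep[x [m' [xa /IHmu[sm ltm] ->]]] /=; split; first by rewrite sm.
by case=> //=; move: xa; rewrite mem_iota.
Qed.

Lemma parts_tuple n (t : n.-tuple nat) : parts (tnth t) = t.
Proof. exact: map_tnth_enum. Qed.

(** So [nuP] applies to every extension, whatever h is. *)
Lemma level_ext_weak n (M : set 'rV[Zp]_n) k d h :
  level k M -> level (k + d) (ext d h M).
Proof.
move=> [latM Mk]; split; first exact: ext_sublattice.
move=> v; exists (p%:R ^+ k * hd v); rewrite hdZ tlZ; split.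
  by rewrite exprD mulrAC.
by rewrite exprD -!scalerA -scalerBr.
Qed.

Definition Ymon (R : comNzRingType) (Y : nat -> R) n (L : set 'rV[Zp]_n) :=
  \prod_(i < n) Y i ^+ tnth (delta L) i.

(** The lattices of level k in rank n + 1 are the extensions of those in rank n
    by d <= k and by one representative h for every residue vector, as far as
    they are again of level k; the others have weight 0 in [ext_gf]. *)
Lemma enum_step n k (s : seq (set 'rV[Zp]_n)) :
  uniq s -> (forall M, M \in s <-> level k M) ->
  exists s' : seq (set 'rV[Zp]_n.+1),
    [/\ uniq s', forall L, L \in s' <-> level k L
      & forall (R : comNzRingType) (X Y : nat -> R),
          \sum_(L <- s') type_weight X k (nu L) * Ymon Y L
          = \sum_(M <- s) Ymon (Y \o succn) M * ext_gf p X (Y 0%N) k (nu M)].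
Proof.
move=> uniq_s mem_s.
have /choice[f fP] (M : set 'rV[Zp]_n) : exists f, level k M -> presents p M (tnth (nu M)) f.
  have [levM|nlevM] := pselect (level k M); last by exists (fun _ _ => 0).
  by have [_ [f Pf]] := nuP p_pr levM; exists f.
(* A vector with prescribed coordinates in the presentation of the quotient
   by M. *)
have /choice[rep repP] (Mm : set 'rV[Zp]_n * seq nat) : exists h,
    level k Mm.1 -> Mm.2 \in residues p (nu Mm.1) ->
    residual p (tnth (nu Mm.1)) (f Mm.1 h) = Mm.2.
  case: Mm => M m /=; have [levM|nlevM] := pselect (level k M); last by exists 0.
  have [h hm] := pres_surj (fP M levM) (fun i => Posz (nth 0%N m i)); exists h.
  move=> _ /mem_residues[sm ltm]; apply: (@eq_from_nth _ 0%N).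
    by rewrite size_map size_enum_ord sm size_tuple.
  move=> i; rewrite size_map size_enum_ord => lt_i.
  have Ei : nth (Ordinal lt_i) (enum 'I_n) i = Ordinal lt_i.
    by apply/val_inj; rewrite /= nth_enum_ord.
  rewrite (nth_map (Ordinal lt_i)) ?size_enum_ord // Ei (eq_resn (hm _)).
  rewrite /resn modz_small //= ltz_nat (tnth_nth 0%N); exact: ltm.
pose E M (dm : nat * seq nat) := ext dm.1 (rep (M, dm.2)) M.
pose dms (M : set 'rV[Zp]_n) := [seq (d, m) | d <- iota 0 k.+1, m <- residues p (nu M)].
pose t := [seq E M dm | M <- s, dm <- dms M].
have dms_res M dm : dm \in dms M -> dm.2 \in residues p (nu M).
  by case/allpairsP=> -[d m] [/= _ m_res ->].
have E_inj M M' dm dm' : M \in s -> M' \in s -> dm \in dms M -> dm' \in dms M' ->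
    E M dm = E M' dm' -> M = M' /\ dm = dm'.
  move=> /mem_s levM /mem_s levM' /dms_res m_res /dms_res m_res' eqE.
  have [eM ed Mh] := ext_inj p_pr (proj1 levM) (proj1 levM') eqE; split=> //.
  subst M'; move: ed m_res m_res' Mh {eqE}; case: dm => d m; case: dm' => d' m' /=.
  move=> ed m_res m_res' Mh.
  congr (_, _) => //.
  have := repP (M, m) levM m_res; have := repP (M, m') levM m_res' => /= <- <-.
  apply: eq_map => i; apply: eq_resn; apply/eqP; rewrite eqz_mod_dvd.
  have /(pres_ker (fP M levM))/(_ i)/eqmod0P := Mh.
  by rewrite (pres_sub (fP M levM)) => /eqmod0P.
have uniq_t : uniq t.
  apply: allpairs_uniq_dep => //.
    move=> M _; apply: allpairs_uniq; rewrite ?iota_uniq ?uniq_residues //.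
    by move=> [x m] [x' m'] _ _ /= [-> ->].
  move=> [M dm] [M' dm'] /allpairsPdep[? [? [sM dM e1]]] /allpairsPdep[? [? [sM' dM' e2]]] /=.
  case: e1 sM dM => -> -> sM dM; case: e2 sM' dM' => -> -> sM' dM' /=.
  by move=> /(E_inj _ _ _ _ sM sM' dM dM')[-> ->].
exists [seq L <- t | `[< level k L >]]; split.
- exact: filter_uniq.
- move=> L; rewrite mem_filter; split=> [/andP[/asboolP//]|levL].
  apply/andP; split; first exact/asboolP.
  have [d [h [le_dk LE]]] := level_ext p_pr levL.
  have levM := kern_level levL; set M := kern L in LE levM.
  pose m := residual p (tnth (nu M)) (f M h).
  have m_res : m \in residues p (nu M).
    by rewrite -[X in residues p X]parts_tuple; apply: residual_residues.
  apply/allpairsPdep; exists M, (d, m); split; first exact/mem_s.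
    by apply/allpairsP; exists (d, m); split; rewrite ?mem_iota.
  rewrite {1}LE /E /=; apply: eq_ext; first by case: levM.
  apply/(pres_ker (fP M levM)) => i; apply/eqmod0P; rewrite (pres_sub (fP M levM)).
  apply/eqmod0P; rewrite -eqz_mod_dvd; apply/eqP.
  have /= := repP (M, m) levM m_res; rewrite /m /residual => /eq_in_map/(_ i).
  rewrite mem_enum => /(_ isT) => /(congr1 Posz).
  by rewrite !resnE.
move=> R X Y; rewrite big_filter big_mkcond /= big_allpairs_dep /=.
apply: eq_big_seq => M /mem_s levM; rewrite /ext_gf mulr_sumr big_allpairs_dep /=.
apply: eq_bigr => d _; rewrite mulr_sumr; apply: eq_big_seq => m m_res.
rewrite /E /=; set h := rep _.
have [_ [fL PL]] := nuP p_pr (level_ext_weak d h levM).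
have := ext_weightE p_pr X k (proj1 levM) (fP M levM) PL.
rewrite (repP (M, m) levM m_res) /= !parts_tuple => ->.
have levE : level k (ext d h M) <-> [forall i, (tnth (nu (ext d h M)) i <= k)%N].
  have expP := pres_exponent p_pr k PL; split=> [[_ Lk]|/forallP nuk].
    by apply/forallP; apply: (proj1 expP) => v; rewrite -scale_expn.
  split; first by apply: ext_sublattice; case: levM.
  by move=> v; rewrite scale_expn; apply: (proj2 expP).
case: asboolP => [/levE->|nlev]; last first.
  case: ifP => [/levE//|_]; by rewrite !mulr0.
rewrite /Ymon (delta_ext p_pr d h levM) big_ord_recl tnth0 /=.
under eq_bigr => i _ do rewrite tnthS.
by rewrite mulrA mulrC; congr (_ * _); exact: mulrC.
Qed.

Lemma subst_ordge N (T y : {mpoly int[N]}) X s :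
  (forall i, ordge 1 (X i.+1)) -> forall i, ordge 1 (subst_vars T X y s i.+1).
Proof.
move=> oX i; rewrite /subst_vars /branch; case: (bit s _); first exact: ordge_up.
exact: ordge_lo.
Qed.

(** The truncated form of the identity den * HS = num. *)
Lemma hs_trunc n k : exists s : seq (set 'rV[Zp]_n),
  [/\ uniq s, forall L, L \in s <-> level k L
    & forall N (X Y : nat -> {mpoly int[N]}), X 0%N = 1 ->
        (forall i, ordge 1 (X i.+1)) ->
        ordge k.+1 (hs_den n p%:R X Y * (\sum_(L <- s) type_weight X k (nu L) * Ymon Y L)
                    - hs_num n p%:R X Y)].
Proof.
elim: n => [|n [s [uniq_s mem_s sP]]].
  have full (L : set 'rV[Zp]_0) : sublattice L -> L = setT.
    move=> latL; apply/seteqP; split=> // v _.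
    by rewrite (_ : v = 0); [apply: lat0 | apply/rowP => -[]].
  exists [:: setT]; split=> // [L|N X Y X0 oX].
    rewrite inE; split=> [/eqP->|[latL _]]; last by apply/eqP/full.
    by split=> //; apply/sublatticeP.
  rewrite big_seq1 /= mul1r /Ymon big_ord0 mulr1 /type_weight big_seq big1 ?subrr.
    by move=> m _; rewrite mcoeff0.
  by move=> c /mapP[j _ ->]; rewrite (tuple0 (nu _)) X0.
have [s' [uniq_s' mem_s' s'P]] := enum_step uniq_s mem_s.
exists s'; split=> // N X Y X0 oX; rewrite s'P /=.
set T : {mpoly int[N]} := p%:R; set y := Y 0%N; set Y' := Y \o succn.
pose d b := hs_den n T (subst_vars T X y b) Y'.
pose a b := hs_num n T (subst_vars T X y b) Y'.
pose S b := \sum_(M <- s) type_weight (subst_vars T X y b) k (nu M) * Ymon Y' M.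
have nu_k (M : set 'rV[Zp]_n) : M \in s -> all (leq^~ k) (nu M).
  move=> /mem_s levM; have [_ [f Pf]] := nuP p_pr levM.
  rewrite -[X in all _ X]parts_tuple; apply/all_parts.
  by apply: (proj1 (pres_exponent p_pr k Pf)) => v; rewrite -scale_expn; apply: (proj2 levM).
have step : ordge k.+1 (gaps T X y n * (\sum_(M <- s) Ymon Y' M * ext_gf p X y k (nu M))
                        - \sum_(b <- bits n) branch_coef T X y b * S b).
  have -> : \sum_(b <- bits n) branch_coef T X y b * S b
      = \sum_(M <- s) Ymon Y' M * \sum_(b <- bits n)
          branch_coef T X y b * type_weight (subst_vars T X y b) k (nu M).
    under eq_bigr => b _ do rewrite mulr_sumr.
    rewrite exchange_big /=; apply: eq_bigr => M _; rewrite mulr_sumr.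
    by apply: eq_bigr => b _; ring.
  rewrite mulr_sumr -sumrB; apply: ordge_sum => M sM.
  have := gaps_ext_gf_trunc y p_gt1 X0 oX (nu_k M sM); rewrite size_tuple => oM.
  by rewrite mulrCA -mulrBr; apply: ordgeMl.
have -> : gaps T X y n * \prod_(b <- bits n) d b
      * (\sum_(M <- s) Ymon Y' M * ext_gf p X y k (nu M))
    - \sum_(b <- bits n) branch_coef T X y b * a b * \prod_(b' <- bits n | b' != b) d b'
  = \prod_(b <- bits n) d b *
      (gaps T X y n * (\sum_(M <- s) Ymon Y' M * ext_gf p X y k (nu M))
        - \sum_(b <- bits n) branch_coef T X y b * S b)
    + \sum_(b <- bits n) branch_coef T X y b * \prod_(b' <- bits n | b' != b) d b'
        * (d b * S b - a b).
  rewrite mulrBr mulrCA mulrA -addrA; congr (_ + _).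
  rewrite mulr_sumr -!sumrN -big_split /=; apply: eq_big_seq => b bP.
  by rewrite (bigD1_seq b) ?uniq_bits //=; ring.
apply: ordgeD; first exact: ordgeMl.
apply: ordge_sum => b _; apply: ordgeMl; apply: sP; first by rewrite subst0.
exact: subst_ordge.
Qed.

End Enumeration.

(** * Coefficients of the Hermite-Smith series *)

Section Multiplicities.

(** The number of columns of a given height is a difference of consecutive
    parts. The lower bound b on the parts makes the induction work: the smallest
    part becomes the bound for the others. *)
Lemma count_mem_heights b K nu i :
  path leq b nu -> all (leq^~ K) nu -> (b <= K)%N -> (i < size nu)%N ->
  count_mem i.+1 [seq count (ltn j) nu | j <- iota b (K - b)]
  = (nth 0 (b :: nu) (size nu - i) - nth 0 (b :: nu) (size nu - i.+1))%N.
Proof.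
elim: nu b i => //= a nu IHnu b i /andP[le_ba path_nu] /andP[le_aK le_K] le_bK lt_i.
have -> : iota b (K - b) = iota b (a - b) ++ iota a (K - a).
  by rewrite -{2}(subnKC le_ba) -iotaD; congr iota; lia.
have ge_a : all (leq a) nu by apply: order_path_min path_nu; exact: leq_trans.
rewrite map_cat count_cat.
have -> : [seq ((j < a) + count (ltn j) nu)%N | j <- iota b (a - b)]
    = nseq (a - b) (size nu).+1.
  rewrite -[in RHS](size_iota b (a - b)).
  rewrite -[in RHS](size_map (fun j => (j < a) + count (ltn j) nu)%N).
  apply/all_pred1P; rewrite all_map; apply/allP => j.
  rewrite mem_iota subnKC // => /andP[_ lt_ja] /=; rewrite lt_ja add1n eqSS -all_count.
  by apply: sub_all ge_a => c /=; apply: leq_trans.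
rewrite count_nseq /= [(size nu).+1 == _]eq_sym.
have -> : [seq ((j < a) + count (ltn j) nu)%N | j <- iota a (K - a)]
    = [seq count (ltn j) nu | j <- iota a (K - a)].
  by apply/eq_in_map => j; rewrite mem_iota => /andP[le_aj _]; rewrite ltnNge le_aj.
have [lt_in|ge_in] := ltnP i (size nu).
  rewrite IHnu // eqSS (ltn_eqF lt_in) mul0n add0n subSS.
  have [c cE] : exists c, (size nu - i = c.+1)%N by exists (size nu - i).-1; lia.
  by rewrite subSn ?(ltnW lt_in) // cE /= (_ : size nu - i.+1 = c)%N //; lia.
have -> : i = size nu by lia.
rewrite eqxx mul1n subSnn subnn /= (_ : count_mem _ _ = 0%N) ?addn0 //.
apply/count_memPn/mapP => -[j _ E].
by have := count_size (ltn j) nu; rewrite -E ltnn.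
Qed.

End Multiplicities.

Section Coefficients.
Variable p : nat.
Hypothesis p_pr : prime p.
Let p_gt1 : (1 < p)%N. Proof. exact: prime_gt1. Qed.
Local Notation Zp := (padic_int p).
Local Open Scope classical_set_scope.

Lemma heights_leq m (t : m.-tuple nat) k : all (leq^~ m) (col_heights k t).
Proof.
apply/allP => c /heights_leq_rk /= le_c; apply: leq_trans le_c _.
by rewrite -[X in (_ <= X)%N](size_tuple t) count_size.
Qed.

Section Exponents.
Variables (n K : nat) (L : set 'rV[Zp]_n).
Hypothesis levL : level K L.

Lemma mult_mu k (i : 'I_n) : all (leq^~ k) (nu L) ->
  count_mem i.+1 (col_heights k (nu L)) = mu L i.
Proof.
move=> le_nu; have [sorted_nu _] := nuP p_pr levL.
rewrite /col_heights -[X in iota 0 X]subn0 count_mem_heights ?size_tuple //.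
by case: (tval (nu L)) sorted_nu => //= a s ->.
Qed.

(** The largest exponent is the number of columns of positive height. Hence
    only lattices of level k contribute to the coefficients of degree at most
    k; see [HS_sum]. *)
Lemma nu_leq_mu : all (leq^~ (\sum_i mu L i)%N) (nu L).
Proof.
have [sorted_nu _] := nuP p_pr levL.
pose k := last 0%N (nu L).
have le_k : all (leq^~ k) (nu L).
  apply/allP => a /(nthP 0%N)[i lt_i <-]; rewrite /k -nth_last.
  apply: (sorted_leq_nth leq_trans leqnn) => //; rewrite ?inE.
    by rewrite prednK //; apply: leq_ltn_trans lt_i.
  by rewrite -ltnS prednK //; apply: leq_ltn_trans lt_i.
suff -> : (\sum_i mu L i)%N = k by [].
have := sum_count (heights_leq (nu L) k); rewrite size_map size_iota big_ord_recl /=.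
rewrite (_ : count_mem _ _ = 0%N) ?add0n => [<-|].
  by apply: eq_bigr => i _; rewrite -(mult_mu i le_k).
apply/count_memPn/mapP => -[j]; rewrite mem_iota => /andP[_ lt_j] /esym E.
have : has (ltn j) (nu L).
  apply/hasP; exists k => //; rewrite /k -nth_last mem_nth // prednK //.
  by move: lt_j; rewrite add0n /k; case: (tval (nu L)).
by rewrite has_count E.
Qed.

End Exponents.

Variable n' : nat.
Local Notation n := n'.+1.

(** Families indexed by all natural numbers, as the recursion wants them, with
    X_0 = 1. [inord] repeats variables beyond the last index, so that all of
    them are nonzero. *)
Definition xvars (R : nzRingType) (g : 'I_n -> R) i : R :=
  if i is j.+1 then g (inord j) else 1.
Definition yvars (R : nzRingType) (g : 'I_n -> R) i : R := g (inord i).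

Lemma rmorph_xvars (R S : nzRingType) (f : {rmorphism R -> S}) g :
  f \o xvars g = xvars (f \o g).
Proof. by apply/funext => -[|j] /=; rewrite ?rmorph1. Qed.

Local Notation P := {mpoly int[n + n]}.
Definition Xmon : nat -> P := xvars (fun i => 'X_(lshift n i)).
Definition Ymon_var : nat -> P := yvars (fun i => 'X_(rshift n i)).

Lemma Xmon_ordge i : ordge 1 (Xmon i.+1).
Proof.
move=> m; rewrite ltnS leqn0 mdeg_eq0 => /eqP->; rewrite mcoeffX.
by case: eqP => // /(congr1 (@mdeg _)); rewrite mdeg1 mdeg0.
Qed.

Lemma term_exponent K k (L : set 'rV[Zp]_n) : level K L -> all (leq^~ k) (nu L) ->
  type_weight Xmon k (nu L) * Ymon Ymon_var L = 'X_[hs_exponent L].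
Proof.
move=> levL le_k; rewrite mpolyXE_id big_split_ord /=; congr (_ * _).
  rewrite /type_weight (@prod_count _ _ n) ?heights_leq //.
  rewrite big_ord_recl /= expr1n mul1r; apply: eq_bigr => i _.
  rewrite /bump /= add1n inord_val; congr (_ ^+ _).
  by rewrite (mult_mu levL) // mnmE (unsplitK (inl i)).
apply: eq_bigr => i _; rewrite /Ymon_var /yvars inord_val mnmE.
by rewrite (unsplitK (inr i)).
Qed.

Variables (k : nat) (s : seq (set 'rV[Zp]_n)).
Hypotheses (uniq_s : uniq s) (mem_s : forall L, L \in s <-> level k L).
Let S : P := \sum_(L <- s) type_weight Xmon k (nu L) * Ymon Ymon_var L.

Lemma level_nu (L : set 'rV[Zp]_n) K j : level K L -> all (leq^~ j) (nu L) <-> level j L.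
Proof.
move=> levL; have [_ [f Pf]] := nuP p_pr levL.
have E := pres_exponent p_pr j Pf.
rewrite -[X in all _ X]parts_tuple; split=> [/all_parts nuj|[_ Lj]].
  by split=> [|v]; [case: levL | rewrite scale_expn; apply: (proj2 E)].
by apply/all_parts/(proj1 E) => v; rewrite -scale_expn.
Qed.

Lemma HS_sum m : (mdeg m <= k)%N -> @HS n p m = S@_m.
Proof.
move=> le_mk; rewrite /HS.
have -> : S = \sum_(L <- s) 'X_[hs_exponent L].
  apply: eq_big_seq => L /mem_s levL; apply: term_exponent (levL) _.
  exact/(level_nu _ levL).
rewrite raddf_sum /=; under [RHS]eq_bigr => L _ do rewrite mcoeffX.
rewrite (fsbig_seq _ _ uniq_s).
apply/esym/fsbig_widen => [L /= /mem_s levL|L [[latL finL] /= nsL]].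
  by split; [case: levL | apply/(finite_index_levelP p_gt1); [case: levL | exists k]].
apply/eqP; rewrite pnatr_eq0 eqb0; apply/negP => /eqP mE; apply: nsL; apply/mem_s.
have [K levL] := proj1 (finite_index_levelP p_gt1 latL) finL.
apply/(level_nu k levL); apply: sub_all (nu_leq_mu levL) => a /= le_a.
apply: leq_trans le_a (leq_trans _ le_mk).
rewrite -mE mdegE big_split_ord /= -[X in (X <= _)%N]addn0 leq_add //.
by apply: leq_sum => i _; rewrite mnmE (unsplitK (inl i)).
Qed.

Lemma mul_series (D : P) m : (mdeg m <= k)%N ->
  poly_mul_series D (@HS n p) m = (D * S)@_m.
Proof.
move=> le_mk; rewrite /poly_mul_series [in RHS](mpolyE D) mulr_suml raddf_sum /=.
rewrite big_mkcond; apply: eq_bigr => j _; rewrite -scalerAl mcoeffZ.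
case: ifP => [le_j|nle_j].
  have -> : ('X_[j] * S)@_m = S@_(m - j)%MM.
    by rewrite -[in LHS](submK le_j) addmC mulrC mcoeffMX.
  rewrite HS_sum //; apply: leq_trans le_mk.
  by have := congr1 (@mdeg _) (submK le_j); rewrite mdegD => <-; apply: leq_addr.
rewrite mcoeffM big1 ?mulr0 // => -[a b] /= /eqP mE; rewrite mcoeffX.
case: eqP => [E|]; last by rewrite mul0r.
have : (j <= a + b)%MM by rewrite E lem_addr.
by rewrite -mE nle_j.
Qed.

End Coefficients.

(** * Specialisation at primes and inversion of variables *)

Section Fractions.
Variable R : idomainType.

(** The numerator and denominator by which [invert] is defined. *)
Lemma frac_repr (W : {fraction R}) :
  W = FracField.tofrac \n_(repr W) / FracField.tofrac \d_(repr W).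
Proof.
have d0 : FracField.tofrac \d_(repr W) != 0 by rewrite tofrac_eq0 denom_ratioP.
apply: (canRL (mulfK d0)).
rewrite -{1}[W]reprK; unlock FracField.tofrac; rewrite -[LHS]FracField.pi_mul.
apply/eqmodP; rewrite /= FracField.equivfE /FracField.mulf /=.
by rewrite !numden_Ratio ?(oner_eq0, mulf_neq0, denom_ratioP, mulr1) // mulrC.
Qed.

End Fractions.

Lemma mpolyC_int N (a : int) : a%:MP_[N] = a%:~R :> {mpoly int[N]}.
Proof. by rewrite -{1}[a]intz rmorph_int. Qed.

Lemma mpolyX_neq0 N (m : 'X_{1.. N}) : ('X_[m] : {mpoly int[N]}) != 0.
Proof.
apply/eqP => /(congr1 (mcoeff m)); rewrite mcoeffX eqxx mcoeff0.
by move/eqP; rewrite oner_eq0.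
Qed.

Section EvalPrimes.
Variable n : nat.

Lemma many_primes N : exists rs : seq nat, [/\ size rs = N, uniq rs & all prime rs].
Proof.
elim: N => [|N [rs [<- uniq_rs pr_rs]]]; first by exists [::].
have [q lt_q pr_q] := prime_above (\max_(r <- rs) r).
exists (q :: rs); split=> //=; last by rewrite pr_q.
rewrite uniq_rs andbT; apply/negP => q_rs.
by move: lt_q; rewrite ltnNge (leq_bigmax_seq (F := id) q q_rs).
Qed.

Lemma poly_prime_roots (u : {poly int}) :
  (forall p : nat, prime p -> u.[p%:R] = 0) -> u = 0.
Proof.
move=> u0; apply: contraTeq isT => nzu.
have [rs [sz uniq_rs pr_rs]] := many_primes (size u).
have := max_poly_roots nzu (rs := [seq (r%:R : int) | r <- rs]).
rewrite size_map sz ltnn map_inj_uniq ?uniq_rs; last first.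
  by move=> a b /eqP; rewrite eqr_nat => /eqP.
apply=> //; rewrite all_map; apply: sub_all pr_rs => r /u0 ur /=.
exact/rootP.
Qed.

Definition tail_mnm (m : 'X_{1.. 1 + (n + n)}) : 'X_{1.. n + n} :=
  [multinom m (rshift 1 i) | i < n + n].

Lemma eval_primeE p (B : polyTXY n) : eval_prime p B
  = \sum_(m <- msupp B) (B@_m * p%:R ^+ m (lshift (n + n) ord0)) *: 'X_[tail_mnm m].
Proof.
rewrite /eval_prime /mmap; apply: eq_bigr => m _.
rewrite /mmap1 big_split_ord big_ord1 /= (unsplitK (inl ord0)) mpolyXE_id.
rewrite -mul_mpolyC mpolyCM mpolyC_int rmorphXn /= mpolyC_nat mulrA.
congr (_ * _); apply: eq_bigr => i _.
by rewrite (unsplitK (inr i)) mnmE.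
Qed.

(** The coefficients of the monomials in X and Y are polynomials in T with
    infinitely many roots. *)
Lemma eval_primes_inj (B : polyTXY n) :
  (forall p, prime p -> eval_prime p B = 0) -> B = 0.
Proof.
move=> B0; apply/mpolyP => m1; rewrite mcoeff0; apply/eqP; rewrite mcoeff_eq0.
apply/negP => m1B.
pose o := lshift (n + n) (ord0 : 'I_1).
pose u : {poly int} :=
  \sum_(m <- msupp B | tail_mnm m == tail_mnm m1) B@_m *: 'X^(m o).
have u0 : u = 0.
  apply: poly_prime_roots => p /B0 /(congr1 (mcoeff (tail_mnm m1))).
  rewrite eval_primeE raddf_sum mcoeff0 /= => <-.
  rewrite /u big_mkcond horner_sum; apply: eq_bigr => m _.
  rewrite mcoeffZ mcoeffX; case: eqP => _; last by rewrite horner0 mulr0.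
  by rewrite hornerZ hornerXn mulr1.
have := congr1 (coefp (m1 o)) u0; rewrite /= coef0 /u coef_sum.
rewrite (big_rem m1) //= eqxx coefZ coefXn eqxx mulr1 big_seq_cond big1 ?addr0.
  by apply/eqP; rewrite -mcoeff_msupp.
move=> m /andP[m_rem /eqP tl_eq]; rewrite coefZ coefXn.
case: eqP => [o_eq|]; last by rewrite mulr0.
suff E : m = m1 by move: m_rem; rewrite E mem_rem_uniqF ?msupp_uniq.
apply/mnmP => i; case: (split_ordP i) => j ->; first by rewrite ord1.
by have /mnmP/(_ j) := tl_eq; rewrite !mnmE.
Qed.

End EvalPrimes.

Section InvertPoly.
Variable K : nat.

(** Multiplied by a monomial that is divisible by all monomials of A, the
    inverted polynomial is A with its exponents reflected. *)
Lemma invert_neq0 (A : {mpoly int[K]}) : A != 0 ->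
  mmap (intr : int -> {fraction {mpoly int[K]}})
       (fun k => (FracField.tofrac 'X_k)^-1) A != 0.
Proof.
move=> nzA; pose b : 'X_{1.. K} := [multinom msize A | i < K].
have le_b m : m \in msupp A -> (m <= b)%MM.
  move=> mA; apply/mnm_lepP => i; rewrite mnmE.
  apply: leq_trans (ltnW (msize_mdeg_lt mA)).
  by rewrite mdegE (bigD1 i) //= leq_addr.
pose B := \sum_(m <- msupp A) A@_m *: 'X_[(b - m)%MM].
have BE : FracField.tofrac 'X_[b] * mmap (intr : int -> {fraction {mpoly int[K]}})
       (fun k => (FracField.tofrac 'X_k)^-1) A = FracField.tofrac B.
  rewrite /mmap mulr_sumr rmorph_sum; apply: eq_big_seq => m mA /=.
  rewrite mulrCA -mul_mpolyC rmorphM mpolyC_int rmorph_int; congr (_ * _).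
  rewrite -{1}(submK (le_b m mA)) mpolyXD rmorphM -mulrA.
  rewrite [in X in _ * (X * _)]mpolyXE_id rmorph_prod /mmap1 -big_split /=.
  rewrite big1 ?mulr1 // => i _; rewrite rmorphXn -exprMn divff ?expr1n //.
  by rewrite tofrac_eq0 mpolyX_neq0.
apply/eqP => A0; move: BE; rewrite A0 mulr0 => /esym/eqP; rewrite tofrac_eq0 => /eqP B0.
have m1A := mlead_supp nzA; set m1 := mlead A in m1A.
have := congr1 (mcoeff (b - m1)%MM) B0; rewrite mcoeff0 /B raddf_sum (big_rem m1) //=.
rewrite mcoeffZ mcoeffX eqxx mulr1 big_seq big1 ?addr0.
  by apply/eqP; rewrite -mcoeff_msupp.
move=> m m_rem; rewrite mcoeffZ mcoeffX; case: eqP => [E|]; last by rewrite mulr0.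
suff Em : m = m1 by move: m_rem; rewrite Em mem_rem_uniqF ?msupp_uniq.
have /mnm_lepP le_m := le_b m (mem_rem m_rem); have /mnm_lepP le_m1 := le_b _ m1A.
apply/mnmP => i; have /mnmP/(_ i) := E; rewrite !mnmBE.
by have := le_m i; have := le_m1 i; lia.
Qed.

End InvertPoly.

(** * The rational function and its functional equation *)

Section Main.
Variable n' : nat.
Local Notation n := n'.+1.
Local Notation PXY := {mpoly int[n + n]}.

Definition polyT : polyTXY n := 'X_(lshift (n + n) ord0).
Definition polyX : nat -> polyTXY n := xvars (fun i : 'I_n => 'X_(rshift 1 (lshift n i))).
Definition polyY : nat -> polyTXY n := yvars (fun i : 'I_n => 'X_(rshift 1 (rshift n i))).
Definition numTXY := hs_num n polyT polyX polyY.
Definition denTXY := hs_den n polyT polyX polyY.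
Definition ratHS : ratTXY n := FracField.tofrac numTXY / FracField.tofrac denTXY.

Lemma eval_prime_vars p (f : {rmorphism polyTXY n -> PXY}) :
  f =1 @eval_prime n p ->
  [/\ f polyT = p%:R, f \o polyX = @Xmon n' & f \o polyY = @Ymon_var n'].
Proof.
move=> fE.
have fX k : f 'X_k = match split k with inl _ => p%:R | inr j => 'X_j end.
  by rewrite fE /eval_prime mmapX mmap1U.
split.
- by rewrite /polyT fX (unsplitK (inl ord0)).
- rewrite rmorph_xvars; congr xvars; apply/funext => i /=.
  by rewrite fX (unsplitK (inr (lshift n i))).
- apply/funext => i /=; rewrite /polyY /yvars fX.
  by rewrite (unsplitK (inr (rshift n (inord i)))).
Qed.

Lemma eval_prime_num p : eval_prime p numTXY = hs_num n p%:R (@Xmon n') (@Ymon_var n').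
Proof.
pose f : {rmorphism polyTXY n -> PXY} := mmap intr
  (fun k => match split k with inl _ => p%:R | inr j => 'X_j end).
have [fT fX fY] := @eval_prime_vars p f (fun=> erefl).
by rewrite -[LHS]/(f _) rmorph_hs_num fT fX fY.
Qed.

Lemma eval_prime_den p : eval_prime p denTXY = hs_den n p%:R (@Xmon n') (@Ymon_var n').
Proof.
pose f : {rmorphism polyTXY n -> PXY} := mmap intr
  (fun k => match split k with inl _ => p%:R | inr j => 'X_j end).
have [fT fX fY] := @eval_prime_vars p f (fun=> erefl).
by rewrite -[LHS]/(f _) rmorph_hs_den fT fX fY.
Qed.

(** Evaluate at X_i = 2^-i and Y_i = (2 p)^-i, where [hs_den_gt0] applies. *)
Lemma hs_den_neq0 p : (0 < p)%N -> hs_den n p%:R (@Xmon n') (@Ymon_var n') != 0.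
Proof.
move=> p_gt0; pose q : rat := p%:R.
have q_ge1 : 1 <= q by rewrite ler1n.
have q_gt0 : 0 < q by exact: lt_le_trans q_ge1.
pose x i : rat := 2 ^- i; pose y i : rat := (2 * q) ^- i.
pose f : {rmorphism PXY -> rat} := mmap intr
  (fun k => match split k with inl i => x i.+1 | inr i => y i end).
apply/eqP => /(congr1 f); rewrite rmorph_hs_den rmorph0 rmorph_nat -/q.
have fX k : f 'X_k = match split k with inl i => x i.+1 | inr i => y i end.
  by rewrite /= mmapX mmap1U.
rewrite (@eq_hs_den _ n q _ x _ y) => [|[|i] le_in|i lt_in].
- apply/eqP/lt0r_neq0; apply: hs_den_gt0 => // [i|i|i|r].
  + by rewrite /x invr_gt0 exprn_gt0.
  + by rewrite /y invr_gt0 exprn_gt0 ?mulr_gt0.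
  + rewrite /y exprS invfM [X in X < _]mulrA -[X in _ < X]mul1r ltr_pM2r.
      by rewrite invfM mulrCA divff ?gt_eqF // mulr1 invf_lt1.
    by rewrite invr_gt0 exprn_gt0 ?mulr_gt0.
  rewrite /up /lo /x /y expr0 invr1 mul1r.
  apply: (@lt_le_trans _ _ (2 ^- r)); last by rewrite ler_peMl ?exprn_ege1 // invr_ge0 exprn_ge0.
  have : 0 < (2 : rat) ^- r by rewrite invr_gt0 exprn_gt0.
  by rewrite exprS invfM; lra.
- by rewrite -[LHS]/(f 1) rmorph1 /x expr0 invr1.
- by rewrite [LHS]fX (unsplitK (inl _)) inordK.
by rewrite [LHS]fX (unsplitK (inr _)) inordK.
Qed.

Lemma denTXY_neq0 : denTXY != 0.
Proof.
apply/eqP => d0; have := hs_den_neq0 (isT : 0 < 1)%N.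
by rewrite -eval_prime_den d0 /eval_prime raddf0 eqxx.
Qed.

Lemma HS_quotient p : prime p -> is_quotient (@HS n p)
  (hs_num n p%:R (@Xmon n') (@Ymon_var n')) (hs_den n p%:R (@Xmon n') (@Ymon_var n')).
Proof.
move=> p_pr; split; first by apply: hs_den_neq0; apply: prime_gt0.
move=> m; have [s [uniq_s mem_s sP]] := hs_trunc p_pr n (mdeg m).
rewrite (mul_series p_pr uniq_s mem_s) //; apply/eqP; rewrite -subr_eq0 -mcoeffB.
by apply/eqP; apply: (sP _ _ _ _ (@Xmon_ordge n')).
Qed.

(** The cross difference lies in every order, by multiplying out with the
    truncations of the series. *)
Lemma quotient_cross p (A D A' D' : PXY) : prime p ->
  is_quotient (@HS n p) A D -> is_quotient (@HS n p) A' D' -> A * D' = A' * D.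
Proof.
move=> p_pr [_ qAD] [_ qAD']; apply/eqP; rewrite -subr_eq0; apply/eqP/mpolyP => m.
have [s [uniq_s mem_s _]] := hs_trunc p_pr n (mdeg m).
set S := \sum_(L <- s) type_weight (@Xmon n') (mdeg m) (nu L) * Ymon (@Ymon_var n') L.
have trunc B E : (forall j, poly_mul_series E (@HS n p) j = B@_j) ->
    ordge (mdeg m).+1 (E * S - B).
  by move=> EB j lt_j; rewrite mcoeffB -(mul_series p_pr uniq_s mem_s) // EB subrr.
have -> : A * D' - A' * D = D * (D' * S - A') - D' * (D * S - A) by ring.
rewrite mcoeff0; have := ordgeD (ordgeMl D (trunc _ _ qAD')) (ordgeN (ordgeMl D' (trunc _ _ qAD))).
exact.
Qed.

Lemma ratHS_uniform : uniformly_rational (@HS n) ratHS.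
Proof.
move=> p p_pr; exists numTXY, denTXY; split=> //.
by rewrite eval_prime_num eval_prime_den; apply: HS_quotient.
Qed.

Lemma eval_primeM p (A B : polyTXY n) :
  eval_prime p (A * B) = eval_prime p A * eval_prime p B.
Proof. exact: rmorphM. Qed.
Lemma eval_primeB p (A B : polyTXY n) :
  eval_prime p (A - B) = eval_prime p A - eval_prime p B.
Proof. exact: rmorphB. Qed.

Lemma frac_eq (a d a' d' : polyTXY n) : d != 0 -> d' != 0 ->
  (FracField.tofrac a / FracField.tofrac d == FracField.tofrac a' / FracField.tofrac d')
  = (a * d' == a' * d).
Proof. by move=> d0 d0'; rewrite eqr_div ?tofrac_eq0 // -!tofracM tofrac_eq. Qed.

Lemma eval_prime_neq0 p (A : polyTXY n) : eval_prime p A != 0 -> A != 0.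
Proof. by apply: contraNneq => ->; rewrite /eval_prime raddf0. Qed.

(** Compare at each prime p: there both fractions describe the same series. *)
Lemma uniform_unique (W : ratTXY n) : uniformly_rational (@HS n) W -> W = ratHS.
Proof.
move=> unifW; set a := \n_(repr W); set d := \d_(repr W).
have d0 : d != 0 by exact: denom_ratioP.
rewrite [LHS]frac_repr -/a -/d; apply/eqP; rewrite frac_eq ?denTXY_neq0 //.
rewrite -subr_eq0; apply/eqP/eval_primes_inj => p p_pr.
have [A [D [WE qAD]]] := unifW p p_pr.
have [D0 _] := qAD.
have cross := quotient_cross p_pr qAD (HS_quotient p_pr).
have /eqP : a * D = A * d.
  by apply/eqP; rewrite -frac_eq ?(eval_prime_neq0 D0) // -frac_repr WE.
move=> /eqP/(congr1 (eval_prime p)); rewrite !eval_primeM => aD.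
rewrite eval_primeB (eval_primeM p a) (eval_primeM p _ d) eval_prime_num eval_prime_den.
move: cross aD D0; set e := eval_prime p => cross aD D0.
set u := hs_num _ _ _ _ in cross *; set v := hs_den _ _ _ _ in cross *.
apply: (mulIf D0); rewrite mul0r.
transitivity (e a * e D * v - e d * (u * e D)); first by ring.
by rewrite aD -cross; ring.
Qed.

(** [invert] can be computed from any numerator and denominator, since the
    inversion of polynomials is multiplicative and injective. *)
Lemma invert_frac (a d : polyTXY n) : d != 0 ->
  invert (FracField.tofrac a / FracField.tofrac d : ratTXY n)
  = invert_poly a / invert_poly d.
Proof.
move=> d0; rewrite /invert; set W := FracField.tofrac a / _.
set a' := \n_(repr W); set d' := \d_(repr W).
have d0' : d' != 0 by exact: denom_ratioP.
have WE := frac_repr W; rewrite -/a' -/d' in WE.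
have : a' * d = a * d' by apply/eqP; rewrite -frac_eq // -WE.
move=> /(congr1 (@invert_poly n)).
have iM (x y : polyTXY n) : invert_poly (x * y) = invert_poly x * invert_poly y.
  exact: rmorphM.
rewrite !iM => E; apply/eqP; rewrite eqr_div ?invert_neq0 //.
by rewrite E.
Qed.

Lemma invert_ratHS : invert ratHS
  = (-1) ^+ n * varT n ^+ 'C(n, 2) * varX ord_max * (\prod_(i < n) varY i) * ratHS.
Proof.
pose T := varT n; pose X := xvars (@varX n); pose Y := yvars (@varY n).
have X0 i : X i != 0.
  by case: i => [|i]; rewrite ?oner_eq0 // tofrac_eq0 mpolyX_neq0.
have Y0 i : Y i != 0 by rewrite tofrac_eq0 mpolyX_neq0.
have T0 : T != 0 by rewrite tofrac_eq0 mpolyX_neq0.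
pose t : {rmorphism polyTXY n -> ratTXY n} := @FracField.tofrac (polyTXY n).
have tX : t \o polyX = X by rewrite rmorph_xvars.
have tY : t \o polyY = Y by [].
have den0 : hs_den n T X Y != 0.
  by rewrite -tX -tY -rmorph_hs_den tofrac_eq0 denTXY_neq0.
have ratE : ratHS = hs_frac n T X Y.
  by rewrite hs_fracE // /ratHS -tX -tY -rmorph_hs_den -rmorph_hs_num.
pose v : {rmorphism polyTXY n -> ratTXY n} := mmap intr (fun k => (FracField.tofrac 'X_k)^-1).
have vX : v \o polyX = (fun i => (X i)^-1).
  rewrite rmorph_xvars; apply/funext => -[|i] /=; first by rewrite invr1.
  by rewrite mmapX mmap1U.
have vY : v \o polyY = (fun i => (Y i)^-1).
  by apply/funext => i; rewrite /= mmapX mmap1U.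
have vT : v polyT = T^-1 by rewrite /= mmapX mmap1U.
have den0' : hs_den n T^-1 (fun i => (X i)^-1) (fun i => (Y i)^-1) != 0.
  by rewrite -vX -vY -vT -rmorph_hs_den invert_neq0 ?denTXY_neq0.
rewrite {1}/ratHS invert_frac ?denTXY_neq0 //.
rewrite -[invert_poly numTXY]/(v _) -[invert_poly denTXY]/(v _).
rewrite rmorph_hs_num rmorph_hs_den vX vY vT -hs_fracE // hs_fracV // -ratE.
congr (_ * _ * _ * _).
  by rewrite /X /= (_ : inord n' = ord_max) //; apply/val_inj; rewrite /= inordK.
by apply: eq_bigr => i _; rewrite /Y /yvars inord_val.
Qed.

End Main.

Theorem theorem3 (n : nat) (n_gt0 : (0 < n)%N) :
  (forall p : nat, prime p -> rational_series (@HS n p))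
  /\ (exists W : ratTXY n, uniformly_rational (@HS n) W)
  /\ (forall W : ratTXY n, uniformly_rational (@HS n) W ->
        invert W =
          (-1) ^+ n * varT n ^+ 'C(n, 2) * varX (rev_ord (Ordinal n_gt0))
          * (\prod_(i < n) varY i) * W).
Proof.
case: n n_gt0 => // n n_gt0; split; last split.
- move=> p p_pr; exists (hs_num n.+1 p%:R (@Xmon n) (@Ymon_var n)).
  by exists (hs_den n.+1 p%:R (@Xmon n) (@Ymon_var n)); apply: HS_quotient.
- by exists (ratHS n); apply: ratHS_uniform.
move=> W /uniform_unique ->; rewrite invert_ratHS.
by congr (_ * varX _ * _ * _); apply/val_inj; rewrite /= subn1.
Qed.
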